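(* Let $J$ be a circular hyperbolic Coxeter diagram with nodes $0,\dots,n$. There exists a constant $C$ depending only on $J$ such that the following holds. Let $P\subset\mathbb{P}^n$ be an $n$-simplex, let $\{\rho_t\}_{t\in\mathbb{R}_+}$ be a simplicial deformation family for $(J,P)$ with properly convex open sets $\Omega_t$, and let $d_t$ be the Hilbert metric on $\Omega_t$. If $1\le k\le n-1$ and $A$ and $B$ are two $k$-dimensional cells of the simplex $P$ such that $E=A\cap B$ is a $(k-1)$-dimensional cell, then $$C\,d_t(x,y)\geq d_t(x,E)+d_t(y,E)$$ for any $x\in A$, $y\in B$ and $t\in\mathbb{R}_+$.
   Context: $\mathbb{P}^n$ is real projective $n$-space, $\mathbb{R}_+=(0,+\infty)$. The $k$-dimensional cells of a simplex are its closed $k$-dimensional faces. $d_t(x,E)=\inf_{z\in E}d_t(x,z)$. **Coxeter diagrams.** A Coxeter diagram $J$ with nodes $0,\dots,n$ is a collection $J=(m_{ij})_{i\ne j}$, $m_{ij}=m_{ji}\in\{2,3,\dots\}\cup\{\infty\}$, viewed as a graph with an edge of weight $m_{ij}$ between $i$ and $j$ iff $m_{ij}\ge 3$. Its Coxeter group is $W_J=\langle\tau_0,\dots,\tau_n\mid \tau_i^2=(\tau_i\tau_j)^{m_{ij}}=1\ (i\neq j)\rangle$ (no relation when $m_{ij}=\infty$). Its Cartan matrix $\mathbf{C}_J$ is the symmetric matrix with diagonal entries $1$ and off-diagonal entries $-\cos(\pi/m_{ij})$. $J$ is *hyperbolic* if $\mathbf{C}_J$ is non-degenerate and not positive definite but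 every proper principal submatrix of $\mathbf{C}_J$ is positive definite; then $W_J$ is identified with a group $\Gamma\subset\mathrm{Isom}(\mathbb{H}^n)$ generated by the orthogonal reflections $\tau_i$ in the faces of a bounded hyperbolic $n$-simplex which is a fundamental domain, the faces numbered $i,j$ meeting at angle $\pi/m_{ij}$; put $X_J=\mathbb{H}^n/\Gamma$. $J$ is *circular* if its graph is a single cycle through all the nodes $0,\dots,n$. **Moduli space.** An open set $\Omega\subset\mathbb{P}^n$ is properly convex if it is a bounded convex subset of some affine chart $\mathbb{R}^n\subset\mathbb{P}^n$. $\mathfrak{P}(X_J)\subset \mathrm{Hom}(\Gamma,\mathrm{PGL}_{n+1}\mathbb{R})/\mathrm{PGL}_{n+1}\mathbb{R}$ (quotient by conjugation) is the set of classes of faithful representations $\rho$ for which there are a properly convex open set $\Omega\subset\mathbb{P}^n$ preserved by $\rho(\Gamma)$ and a $\rho$-equivariant homeomorphism $\mathbb{H}^n\to\Omega$. **Simplicial deformation family.** A projective reflection is an element of $\mathrm{PGL}_{n+1}\mathbb{R}$ conjugate to $\pm\mathrm{diag}(-1,1,\dots,1)$; it is a reflection with respect to an $(n-1)$-face of a simplex if it fixes that face pointwise. Let $P\subset\mathbb{P}^n$ be a (closed) $n$-simplex with $(n-1)$-dimensional faces $P_0,\dots,P_n$. A *simplicial deformation family* for $(J,P)$ is a family of representations $\rho_t:\Gamma\to\mathrm{PGL}_{n+1}\mathbb{R}$, $t\in\mathbb{R}_+$, such that: (1) $\rho_t(\tau_i)$ is a projective reflection with respect to $P_i$ for each $i$;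 (2) $t\mapsto[\rho_t]$ is a bijection $\mathbb{R}_+\to\mathfrak{P}(X_J)$; (3) $\Omega_t=\bigcup_{\gamma\in\Gamma}\rho_t(\gamma)(P)$ is the properly convex open set preserved by $\rho_t$, and $\Omega_t$ converges to $P$ in the Hausdorff topology as $t\to0$ and as $t\to+\infty$. **Hilbert metric.** For $\Omega$ properly convex open and $x\ne y\in\Omega$, in an affine chart containing $\overline\Omega$ let $x',y'\in\partial\Omega$ be such that $x',x,y,y'$ lie in this order on the segment $[x',y']$. Then $d_\Omega(x,y)=\frac12\log\frac{|x'-y||y'-x|}{|x'-x||y'-y|}$. *)

(* Defs.v *)
From HB Require Import structures.
From mathcomp Require Import all_boot all_order all_fingroup all_algebra.
From mathcomp Require Import generic_quotient.
From mathcomp Require Import all_classical all_reals all_analysis.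

Set Implicit Arguments.
Unset Strict Implicit.
Unset Printing Implicit Defensive.

Import Order.TTheory GRing.Theory Num.Theory.
Import numFieldNormedType.Exports.

Local Open Scope classical_set_scope.
Local Open Scope ring_scope.
Local Open Scope quotient_scope.

(* [None] encodes the weight oo; the values [cox_m i i] are irrelevant. *)
Record coxeter_diagram (n : nat) := CoxeterDiagram {
  cox_m :> 'I_n.+1 -> 'I_n.+1 -> option nat;
  cox_m_sym : forall i j, i != j -> cox_m i j = cox_m j i;
  cox_m_ge2 : forall i j k, i != j -> cox_m i j = Some k -> (2 <= k)%N }.

Definition cox_edge n (J : coxeter_diagram n) (i j : 'I_n.+1) : bool :=
  (i != j) && (if J i j is Some k then (3 <= k)%N else true).

(* [s] lists the nodes in their cyclic order along the cycle; a cycle in a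
   simple graph has at least three nodes. *)
Definition circular n (J : coxeter_diagram n) : Prop :=
  (2 <= n)%N /\
  exists s : {perm 'I_n.+1}, forall i j : 'I_n.+1,
    cox_edge J (s i) (s j) = (j == ordS i) || (i == ordS j).

Definition cox_angle (R : realType) n (J : coxeter_diagram n) (i j : 'I_n.+1)
  : R := if J i j is Some k then pi / k%:R else 0.

Definition cartan (R : realType) n (J : coxeter_diagram n) : 'M[R]_n.+1 :=
  \matrix_(i, j) if i == j then 1 else - cos (cox_angle R J i j).

Definition posdefmx (R : realType) m (A : 'M[R]_m) : Prop :=
  forall x : 'cV[R]_m, x != 0 -> 0 < (x^T *m A *m x) 0 0.

Definition principal_submx (R : realType) m (S : {set 'I_m}) (A : 'M[R]_m)
  : 'M[R]_#|S| := mxsub enum_val enum_val A.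

Definition hyperbolic (R : realType) n (J : coxeter_diagram n) : Prop :=
  [/\ cartan R J \in unitmx,
      ~ posdefmx (cartan R J) &
      forall S : {set 'I_n.+1}, S \proper [set: 'I_n.+1]%SET ->
        posdefmx (principal_submx S (cartan R J))].

Section CoxeterGroup.
Context (n : nat) (J : coxeter_diagram n).

(* The congruence on words in the generators defining the Coxeter group; since
   the generators are involutions, no letters for their inverses are needed. *)
Inductive cox_eq : seq 'I_n.+1 -> seq 'I_n.+1 -> Prop :=
| cox_eq_refl u : cox_eq u u
| cox_eq_sym u v : cox_eq u v -> cox_eq v u
| cox_eq_trans u v w : cox_eq u v -> cox_eq v w -> cox_eq u w
| cox_eq_cat u u' v v' :
    cox_eq u u' -> cox_eq v v' -> cox_eq (u ++ v) (u' ++ v')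
| cox_eq_sq i : cox_eq [:: i; i] [::]
| cox_eq_pow i j k : i != j -> J i j = Some k ->
    cox_eq (flatten (nseq k [:: i; j])) [::].

Definition cox_eqb (u v : seq 'I_n.+1) : bool := `[< cox_eq u v >].

Lemma cox_eqb_equiv : equiv_class_of cox_eqb.
Proof.
split=> [u|u v|v u w].
- by apply/asboolP; exact: cox_eq_refl.
- by apply/asboolP/asboolP; exact: cox_eq_sym.
- move=> /asboolP uv /asboolP vw; apply/asboolP; exact: cox_eq_trans uv vw.
Qed.

Canonical cox_eqb_equiv_rel := EquivRelPack cox_eqb_equiv.

Definition cox_group : Type := {eq_quot cox_eqb}.
HB.instance Definition _ := Choice.on cox_group.
HB.instance Definition _ := Quotient.on cox_group.

Definition cox_word (u : seq 'I_n.+1) : cox_group := \pi_cox_group u.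
Definition cox_one : cox_group := cox_word [::].
Definition cox_mul (g h : cox_group) : cox_group := cox_word (repr g ++ repr h).
Definition cox_inv (g : cox_group) : cox_group := cox_word (rev (repr g)).
Definition cox_gen (i : 'I_n.+1) : cox_group := cox_word [:: i].

Lemma cox_wordP u v : cox_word u = cox_word v <-> cox_eq u v.
Proof.
split=> [/(@eqmodP _ cox_eqb_equiv_rel)/asboolP //|uv].
by apply/(@eqmodP _ cox_eqb_equiv_rel)/asboolP.
Qed.

Lemma cox_reprK (g : cox_group) : cox_word (repr g) = g.
Proof. exact: (@reprK _ cox_group g). Qed.

Lemma cox_mulE u v : cox_mul (cox_word u) (cox_word v) = cox_word (u ++ v).
Proof. by apply/cox_wordP/cox_eq_cat; apply/cox_wordP; exact: cox_reprK. Qed.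

Lemma cox_eq_rev u : cox_eq (rev u ++ u) [::].
Proof.
elim: u => [|i u ih]; first exact: cox_eq_refl.
rewrite rev_cons -cats1 -catA /= -[i :: i :: u]/([:: i; i] ++ u).
apply: cox_eq_trans ih; apply: cox_eq_cat; first exact: cox_eq_refl.
by apply: (@cox_eq_cat _ [::] _ u); [exact: cox_eq_sq|exact: cox_eq_refl].
Qed.

Lemma cox_mulA : associative cox_mul.
Proof.
move=> x y z; rewrite -(cox_reprK x) -(cox_reprK y) -(cox_reprK z).
by rewrite !cox_mulE catA.
Qed.

Lemma cox_mul1 : left_id cox_one cox_mul.
Proof. by move=> x; rewrite -(cox_reprK x) cox_mulE. Qed.

Lemma cox_mul1r : right_id cox_one cox_mul.
Proof. by move=> x; rewrite -(cox_reprK x) cox_mulE cats0. Qed.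

Lemma cox_mulV : left_inverse cox_one cox_inv cox_mul.
Proof.
move=> x; rewrite -{2}(cox_reprK x) cox_mulE.
by apply/cox_wordP; exact: cox_eq_rev.
Qed.

Lemma cox_mulVr : right_inverse cox_one cox_inv cox_mul.
Proof.
move=> x; rewrite -{1}(cox_reprK x) cox_mulE.
by apply/cox_wordP; rewrite -{1}(revK (repr x)); exact: cox_eq_rev.
Qed.

HB.instance Definition _ := isGroup.Build cox_group
  cox_mulA cox_mul1 cox_mul1r cox_mulV cox_mulVr.

End CoxeterGroup.

Section Hyperbolic.
Context (R : realType) (n : nat).

Definition diag_refl : 'M[R]_n.+1 :=
  diag_mx (\row_j if j == 0 then -1 else 1).

Definition lorentz (x y : 'cV[R]_n.+1) : R := (x^T *m diag_refl *m y) 0 0.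

(* The hyperboloid model; the hyperbolic distance satisfies
   cosh (d x y) = - lorentz x y. *)
Definition hyp : Type :=
  set_type [set x : 'cV[R]_n.+1 | lorentz x x = -1 /\ 0 < x 0 0].
HB.instance Definition _ := Topological.on hyp.

Definition hyp_vec (x : hyp) : 'cV[R]_n.+1 := set_val x.

Context (J : coxeter_diagram n).

(* [hr_normal i] is the unit outer normal of the i-th face, so that the faces i
   and j meet at the angle theta with
   cos theta = - lorentz (hr_normal i) (hr_normal j).  The action [hr_act]
   identifies the Coxeter group with the reflection group of the simplex. *)
Record hyp_realization := HypRealization {
  hr_act : cox_group J -> hyp -> hyp;
  hr_normal : 'I_n.+1 -> 'cV[R]_n.+1;
  hr_simplex := [set x : hyp | forall i, lorentz (hyp_vec x) (hr_normal i) <= 0];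
  hr_act1 : hr_act 1%g = id;
  hr_actM : forall g h, hr_act (g * h)%g = hr_act g \o hr_act h;
  hr_act_inj : injective hr_act;
  hr_act_gen : forall i x, hyp_vec (hr_act (cox_gen J i) x) =
    hyp_vec x - 2 * lorentz (hyp_vec x) (hr_normal i) *: hr_normal i;
  hr_gram : forall i j,
    lorentz (hr_normal i) (hr_normal j) = cartan R J i j;
  hr_bounded : exists M, forall x y, hr_simplex x -> hr_simplex y ->
    - lorentz (hyp_vec x) (hyp_vec y) <= M;
  hr_cover : \bigcup_g (hr_act g @` hr_simplex) = setT;
  hr_disjoint : forall g, g != 1%g ->
    hr_simplex° `&` (hr_act g @` hr_simplex°) = set0 }.

End Hyperbolic.

Section Projective.
Context (R : realType) (n : nat).

Definition nzvec : Type := set_type [set v : 'cV[R]_n.+1 | v != 0].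
HB.instance Definition _ := Topological.on nzvec.

Definition colinear (u v : nzvec) : bool :=
  `[< exists2 c : R, c != 0 & set_val u = c *: set_val v >].

Lemma colinear_equiv : equiv_class_of colinear.
Proof.
split=> [u|u v|v u w].
- by apply/asboolP; exists 1; rewrite ?oner_neq0 ?scale1r.
- by apply/asboolP/asboolP => -[c c0 e]; exists c^-1; rewrite ?invr_neq0 //;
    rewrite e scalerA mulVf// scale1r.
- move=> /asboolP[c c0 e] /asboolP[d d0 f]; apply/asboolP.
  by exists (c * d); rewrite ?mulf_neq0// e f scalerA.
Qed.

Canonical colinear_equiv_rel := EquivRelPack colinear_equiv.

Definition proj_space : Type := quotient_topology {eq_quot colinear}.
HB.instance Definition _ := Topological.on proj_space.
HB.instance Definition _ := Quotient.on proj_space.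

Definition proj_pt (v : nzvec) : proj_space := \pi_proj_space v.

(* An arbitrary representative of x: all uses below are invariant under
   rescaling it. *)
Definition proj_vec (x : proj_space) : 'cV[R]_n.+1 := set_val (repr x : nzvec).

Definition GL : Type := {A : 'M[R]_n.+1 | A \in unitmx}.
HB.instance Definition _ := Choice.on GL.

Definition proportional (A B : GL) : bool :=
  `[< exists2 c : R, c != 0 & val A = c *: val B >].

Lemma proportional_equiv : equiv_class_of proportional.
Proof.
split=> [u|u v|v u w].
- by apply/asboolP; exists 1; rewrite ?oner_neq0 ?scale1r.
- by apply/asboolP/asboolP => -[c c0 e]; exists c^-1; rewrite ?invr_neq0 //;
    rewrite e scalerA mulVf// scale1r.
- move=> /asboolP[c c0 e] /asboolP[d d0 f]; apply/asboolP.
  by exists (c * d); rewrite ?mulf_neq0// e f scalerA.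
Qed.

Canonical proportional_equiv_rel := EquivRelPack proportional_equiv.

Definition PGL : Type := {eq_quot proportional}.
HB.instance Definition _ := Choice.on PGL.
HB.instance Definition _ := Quotient.on PGL.

Definition pgl (A : GL) : PGL := \pi_PGL A.

Lemma GL_mul_subproof (A B : GL) : val A *m val B \in unitmx.
Proof. by rewrite unitmx_mul (valP A) (valP B). Qed.

Lemma GL_inv_subproof (A : GL) : invmx (val A) \in unitmx.
Proof. by rewrite unitmx_inv (valP A). Qed.

Definition GL_of (A : 'M[R]_n.+1) (uA : A \in unitmx) : GL :=
  exist (fun A : 'M[R]_n.+1 => A \in unitmx) A uA.
Definition GL_one : GL := GL_of (unitmx1 R n.+1).
Definition GL_mul (A B : GL) : GL := GL_of (GL_mul_subproof A B).
Definition GL_inv (A : GL) : GL := GL_of (GL_inv_subproof A).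

Definition pgl_one : PGL := pgl GL_one.
Definition pgl_mul (g h : PGL) : PGL := pgl (GL_mul (repr g) (repr h)).
Definition pgl_inv (g : PGL) : PGL := pgl (GL_inv (repr g)).

Lemma pglP (A B : GL) :
  pgl A = pgl B <-> exists2 c : R, c != 0 & val A = c *: val B.
Proof.
split=> [/(@eqmodP _ proportional_equiv_rel)/asboolP //|uv].
by apply/(@eqmodP _ proportional_equiv_rel)/asboolP.
Qed.

Lemma pgl_reprK (g : PGL) : pgl (repr g) = g.
Proof. exact: (@reprK _ PGL g). Qed.

Lemma pgl_mulE (A B : GL) : pgl_mul (pgl A) (pgl B) = pgl (GL_mul A B).
Proof.
have /pglP[c c0 e] := pgl_reprK (pgl A).
have /pglP[d d0 f] := pgl_reprK (pgl B).
apply/pglP; exists (c * d); rewrite ?mulf_neq0//=.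
by rewrite e f -scalemxAl -scalemxAr scalerA.
Qed.

Lemma pgl_mulA : associative pgl_mul.
Proof.
move=> x y z; rewrite -(pgl_reprK x) -(pgl_reprK y) -(pgl_reprK z) !pgl_mulE.
by congr pgl; apply: val_inj; rewrite /= mulmxA.
Qed.

Lemma pgl_mul1 : left_id pgl_one pgl_mul.
Proof.
move=> x; rewrite -(pgl_reprK x) pgl_mulE.
by congr pgl; apply: val_inj; rewrite /= mul1mx.
Qed.

Lemma pgl_mul1r : right_id pgl_one pgl_mul.
Proof.
move=> x; rewrite -(pgl_reprK x) pgl_mulE.
by congr pgl; apply: val_inj; rewrite /= mulmx1.
Qed.

Lemma pgl_mulV : left_inverse pgl_one pgl_inv pgl_mul.
Proof.
move=> x; rewrite -{2}(pgl_reprK x) pgl_mulE.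
by congr pgl; apply: val_inj; rewrite /= mulVmx// (valP (repr x)).
Qed.

Lemma pgl_mulVr : right_inverse pgl_one pgl_inv pgl_mul.
Proof.
move=> x; rewrite -{1}(pgl_reprK x) pgl_mulE.
by congr pgl; apply: val_inj; rewrite /= mulmxV// (valP (repr x)).
Qed.

HB.instance Definition _ := isGroup.Build PGL
  pgl_mulA pgl_mul1 pgl_mul1r pgl_mulV pgl_mulVr.

Lemma GL_act_subproof (A : GL) (v : nzvec) :
  (val A *m set_val v : 'cV[R]_n.+1) \in [set v : 'cV[R]_n.+1 | v != 0].
Proof.
apply/mem_set => /=; apply/eqP => Av0.
have /set_mem/=/eqP := valP v; apply.
by rewrite -[LHS](mulKmx (valP A)) -/(set_val v) Av0 mulmx0.
Qed.

Definition GL_act (A : GL) (v : nzvec) : nzvec :=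
  exist (fun v => v \in [set v : 'cV[R]_n.+1 | v != 0]) _ (GL_act_subproof A v).

Definition pgl_act (g : PGL) (x : proj_space) : proj_space :=
  proj_pt (GL_act (repr g) (repr x)).

Lemma diag_refl_unit : diag_refl R n \in unitmx.
Proof.
rewrite unitmxE det_diag unitfE; apply/prodf_neq0 => i _; rewrite mxE.
by case: ifP; rewrite ?oppr_eq0 oner_neq0.
Qed.

Definition is_proj_reflection (g : PGL) : Prop :=
  exists h : PGL, g = (pgl (GL_of diag_refl_unit) ^ h)%g.

End Projective.

Section ProjectiveGeometry.
Context (R : realType) (n : nat).
Local Notation P := (proj_space R n).

(* The chart defined by a linear form f <> 0: the complement of the hyperplane
   f = 0, identified by [chart_pt f] with the affine hyperplane f = 1. *)
Definition chart (f : 'rV[R]_n.+1) : set P :=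
  [set x | (f *m proj_vec x) 0 0 != 0].

Definition chart_pt (f : 'rV[R]_n.+1) (x : P) : 'cV[R]_n.+1 :=
  ((f *m proj_vec x) 0 0)^-1 *: proj_vec x.

Definition properly_convex (Omega : set P) : Prop :=
  exists f : 'rV[R]_n.+1, [/\ f != 0, Omega `<=` chart f,
    bounded_set (chart_pt f @` Omega) & convex_set (chart_pt f @` Omega)].

(* The n-simplex whose vertices are the classes of the columns of B, i.e. the
   image of the closed positive orthant under B.  Its cells are its faces
   spanned by sets S of vertices, and its i-th (n-1)-face is the one opposite
   to the i-th vertex. *)
Definition cell (B : GL R n) (S : {set 'I_n.+1}) : set P :=
  @proj_pt R n @` [set v | exists c : 'cV[R]_n.+1,
    [/\ forall i, 0 <= c i 0, forall i, i \notin S -> c i 0 = 0 &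
        set_val v = val B *m c]].

Definition simplex (B : GL R n) : set P := cell B [set: 'I_n.+1]%SET.

Definition face (B : GL R n) (i : 'I_n.+1) : set P := cell B (~: [set i])%SET.

Definition is_cell (B : GL R n) (k : nat) (A : set P) : Prop :=
  exists2 S : {set 'I_n.+1}, #|S| = k.+1 & A = cell B S.

Definition dist_to (d : P -> P -> R) (x : P) (E : set P) : R :=
  inf [set d x z | z in E].

(* The sine of the angle between two lines, a metric inducing the topology of
   projective space.  By compactness, any other such metric defines the same
   Hausdorff topology. *)
Definition proj_dist (x y : P) : R :=
  let dot (u v : 'cV[R]_n.+1) := (u^T *m v) 0 0 in
  let u := proj_vec x in let v := proj_vec y in
  Num.sqrt (1 - dot u v ^+ 2 / (dot u u * dot v v)).

Definition hausdorff_dist (A B : set P) : R :=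
  Num.max (sup [set dist_to proj_dist x B | x in A])
          (sup [set dist_to proj_dist y A | y in B]).

Definition boundary (A : set P) : set P := closure A `\` A°.

(* The candidates for the value of the Hilbert distance of x <> y, one for each
   affine chart f.  By projective invariance of cross-ratios they all agree.
   As the four points are on one line, the choice of the norm is irrelevant. *)
Definition hilbert_value (Omega : set P) (x y : P) : set R :=
  [set r | exists (f : 'rV[R]_n.+1) (x' y' : P) (s u : R),
    let px := chart_pt f x in let py := chart_pt f y in
    let px' := chart_pt f x' in let py' := chart_pt f y' in
    [/\ [/\ f != 0, closure Omega `<=` chart f,
            boundary Omega x' & boundary Omega y'],
        [/\ 0 <= s, s <= u & u <= 1],
        px = px' + s *: (py' - px'), py = px' + u *: (py' - px') &
        r = 2^-1 * ln ((`|px' - py| * `|py' - px|)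
                       / (`|px' - px| * `|py' - py|))]].

Definition hilbert_dist (Omega : set P) (x y : P) : R :=
  if x == y then 0 else xget 0 (hilbert_value Omega x y).

End ProjectiveGeometry.

Section Moduli.
Context (R : realType) (n : nat) (J : coxeter_diagram n).
Context (G : hyp_realization R J).

Definition rep : Type := {multiplicative cox_group J -> PGL R n}.

Definition homeo_onto (h : hyp R n -> proj_space R n)
    (Omega : set (proj_space R n)) : Prop :=
  [/\ continuous h, set_bij setT Omega h &
      exists2 g : proj_space R n -> hyp R n,
        {within Omega, continuous g} & cancel h g].

Definition convex_domain (rho : rep) (Omega : set (proj_space R n)) : Prop :=
  [/\ open Omega, properly_convex Omega,
      forall g, pgl_act (rho g) @` Omega = Omega &
      exists2 h : hyp R n -> proj_space R n, homeo_onto h Omega &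
        forall g x, h (hr_act G g x) = pgl_act (rho g) (h x)].

Definition conj_class (rho : rep) : set rep :=
  [set rho' : rep | exists h : PGL R n, forall g, rho' g = (rho g ^ h)%g].

Definition moduli : set (set rep) :=
  conj_class @`
    [set rho : rep | injective rho /\ exists Omega, convex_domain rho Omega].

Definition tiled_domain (B : GL R n) (rho : rep) : set (proj_space R n) :=
  \bigcup_g (pgl_act (rho g) @` simplex B).

(* Only the values [rho t] with 0 < t matter. *)
Record simplicial_deformation_family (B : GL R n) (rho : R -> rep) : Prop := {
  sdf_reflection : forall t i, 0 < t ->
    is_proj_reflection (rho t (cox_gen J i)) /\
    forall x, face B i x -> pgl_act (rho t (cox_gen J i)) x = x;
  sdf_bij : set_bij [set t : R | 0 < t] moduli (fun t => conj_class (rho t));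
  sdf_domain : forall t, 0 < t -> convex_domain (rho t) (tiled_domain B (rho t));
  sdf_cvg0 :
    hausdorff_dist (tiled_domain B (rho t)) (simplex B) @[t --> 0^'+] --> 0;
  sdf_cvgy :
    hausdorff_dist (tiled_domain B (rho t)) (simplex B) @[t --> +oo] --> 0 }.

End Moduli.

(* Main.v *)
Require Import Defs.
From HB Require Import structures.
From mathcomp Require Import all_boot all_order all_fingroup all_algebra.
From mathcomp Require Import generic_quotient.
From mathcomp Require Import all_classical all_reals all_analysis.
From mathcomp Require Import ring lra.

Set Implicit Arguments.
Unset Strict Implicit.
Unset Printing Implicit Defensive.

Import Order.TTheory GRing.Theory Num.Theory.
Import numFieldNormedType.Exports.

Local Open Scope classical_set_scope.
Local Open Scope ring_scope.

(* Let E be the intersection of A and B, and let F be the set of the reflections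
   tau_i fixing E; it generates a parabolic subgroup W_F, which is finite because
   every proper principal submatrix of the Cartan matrix is positive definite.
   Let N bound the length of the elements of W_F.  Only one generator tau_a in F
   moves the points x of A, and it fixes the points y of B, so that
   d(x, tau_a x) <= d(x, y) + d(y, tau_a x) = 2 d(x, y), and hence
   d(x, g x) <= 2 N d(x, y) for all g in W_F.  Hilbert balls being convex, the
   average z of the orbit W_F x (in suitable linear lifts) satisfies
   d(x, z) <= 2 N d(x, y) too.  It is fixed by W_F, and it lies in E, not only in
   the projective span of E, because the lifts x |-> x - beta_i(x) a_i of the
   reflections satisfy beta_i(a_j) <= 0 for i != j.  Hence C = 4 N works.  All
   distances are compared through the order defined by the cone over Omega_t. *)

(** * Bilinear and linear forms *)

(** Two obstacles shape the argument. The constant may depend on $J$ alone, so the bound on word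
    lengths speaks of the congruence of words and is fixed before any realization or representation
    is given. And the Hilbert distance is defined through a chart and two boundary points, which
    make direct estimates awkward. For lifts v, w in the open cone, exp(2 d) is the least r such
    that w <= c v <= r w for some c > 0. Invariance of the distance and the triangle inequality thus
    become invariance and transitivity of the order, and averaging an orbit amounts to adding
    inequalities. A loss of r per letter and a two-sided comparison give (r^N)^2, that is, a
    distance at most N log r = 2 N d(x, y); the two points x and y contribute equally. The signs
    beta_i(a_j) <= 0 are not part of the definition of a deformation family. They are extracted from
    the equivariant homeomorphism, by transporting the sides of the hyperbolic mirrors to the sides
    of the hyperplanes beta_i = 0. *)

Section BilinearForms.
Context {R : realType} {m : nat}.
Implicit Types (A : 'M[R]_m) (x y c : 'cV[R]_m) (F : {set 'I_m}).

Definition bform A x y : R := (x^T *m A *m y) 0 0.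

Lemma bformDl A x y z : bform A (x + y) z = bform A x z + bform A y z.
Proof. by rewrite /bform linearD /= !mulmxDl mxE. Qed.

Lemma bformDr A x y z : bform A x (y + z) = bform A x y + bform A x z.
Proof. by rewrite /bform !mulmxDr mxE. Qed.

Lemma bformZl A a x y : bform A (a *: x) y = a * bform A x y.
Proof. by rewrite /bform linearZ /= -!scalemxAl mxE. Qed.

Lemma bformZr A a x y : bform A x (a *: y) = a * bform A x y.
Proof. by rewrite /bform -!scalemxAr mxE. Qed.

Lemma bformNl A x y : bform A (- x) y = - bform A x y.
Proof. by rewrite -scaleN1r bformZl mulN1r. Qed.

Lemma bformNr A x y : bform A x (- y) = - bform A x y.
Proof. by rewrite -scaleN1r bformZr mulN1r. Qed.

Lemma bformBl A x y z : bform A (x - y) z = bform A x z - bform A y z.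
Proof. by rewrite bformDl bformNl. Qed.

Lemma bformBr A x y z : bform A x (y - z) = bform A x y - bform A x z.
Proof. by rewrite bformDr bformNr. Qed.

Lemma bformC A x y : A^T = A -> bform A x y = bform A y x.
Proof.
move=> sA; rewrite /bform -[in LHS](trmxK (x^T *m A *m y)) mxE.
by rewrite !trmx_mul trmxK sA mulmxA.
Qed.

Lemma bformE A x y : bform A x y = \sum_i \sum_j x i 0 * A i j * y j 0.
Proof.
rewrite /bform -mulmxA mxE; apply: eq_bigr => i _; rewrite !mxE big_distrr /=.
by apply: eq_bigr => j _; rewrite mulrA.
Qed.

Lemma bform_delta A i j : bform A (delta_mx i 0) (delta_mx j 0) = A i j.
Proof. by rewrite /bform trmx_delta -rowE -colE !mxE. Qed.

Lemma bform_deltal A i y : bform A (delta_mx i 0) y = (A *m y) i 0.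
Proof. by rewrite /bform trmx_delta -mulmxA -rowE mxE. Qed.

Lemma bform_sumE A x y : bform A x y = \sum_i x i 0 * (A *m y) i 0.
Proof. by rewrite /bform -mulmxA mxE; apply: eq_bigr => i _; rewrite mxE. Qed.

End BilinearForms.

Section LinearForms.
Context {R : realType} {m : nat}.
Implicit Types (f : 'rV[R]_m) (v w : 'cV[R]_m).

Definition lform f v : R := (f *m v) 0 0.

Lemma lformD f v w : lform f (v + w) = lform f v + lform f w.
Proof. by rewrite /lform mulmxDr mxE. Qed.

Lemma lformZ f c v : lform f (c *: v) = c * lform f v.
Proof. by rewrite /lform -scalemxAr mxE. Qed.

Lemma lformN f v : lform f (- v) = - lform f v.
Proof. by rewrite -scaleN1r lformZ mulN1r. Qed.

Lemma lformB f v w : lform f (v - w) = lform f v - lform f w.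
Proof. by rewrite lformD lformN. Qed.

Lemma lform0 f : lform f 0 = 0.
Proof. by rewrite -(scale0r 0) lformZ mul0r. Qed.

Lemma lformZl c f v : lform (c *: f) v = c * lform f v.
Proof. by rewrite /lform -scalemxAl mxE. Qed.

Lemma lform_sum (I : Type) (r : seq I) f (v : I -> 'cV[R]_m) :
  lform f (\sum_(i <- r) v i) = \sum_(i <- r) lform f (v i).
Proof. exact: (big_morph _ (lformD f) (lform0 f)). Qed.

End LinearForms.

(** * Positive definite forms with nonpositive off-diagonal entries *)

Section Positivity.
Context {R : realType} {m : nat}.
Implicit Types (A : 'M[R]_m) (x y c : 'cV[R]_m) (F : {set 'I_m}).

Lemma bform_congr p (A : 'M[R]_p) (V : 'M[R]_(p, m)) x y :
  bform (V^T *m A *m V) x y = bform A (V *m x) (V *m y).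
Proof. by rewrite /bform trmx_mul !mulmxA. Qed.

Definition supported F c := forall i, i \notin F -> c i 0 = 0.

Definition negpart c : 'cV[R]_m := \col_i Num.max (- c i 0) 0.
Definition pospart c : 'cV[R]_m := \col_i Num.max (c i 0) 0.

Lemma posnegE c : c = pospart c - negpart c.
Proof.
apply/colP => i; rewrite !mxE.
by case: leP => h; case: leP => h'; lra.
Qed.

(* With [c = p - q], [p, q >= 0] of disjoint supports, [q^T A p <= 0] because
   only off-diagonal entries contribute, while [q^T A c >= 0]. *)
Lemma negpart_bform_le0 A F c :
  (forall i j, i \in F -> j \in F -> i != j -> A i j <= 0) ->
  supported F c -> (forall i, i \in F -> 0 <= (A *m c) i 0) ->
  bform A (negpart c) (negpart c) <= 0.
Proof.
move=> Aoff cF Ac.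
have q0 i : i \notin F -> negpart c i 0 = 0.
  by move=> /cF c0; rewrite mxE c0 oppr0 maxxx.
have qc : 0 <= bform A (negpart c) c.
  rewrite bform_sumE; apply: sumr_ge0 => i _.
  have [iF|/q0 ->] := boolP (i \in F); last by rewrite mul0r.
  by rewrite mulr_ge0 ?Ac// mxE le_max lexx orbT.
have qp : bform A (negpart c) (pospart c) <= 0.
  rewrite bformE; apply: sumr_le0 => i _; apply: sumr_le0 => j _.
  have [iF|/q0 ->] := boolP (i \in F); last by rewrite !mul0r.
  have [jF|jF] := boolP (j \in F); last by rewrite !mxE (cF _ jF) maxxx mulr0.
  have [<-|ij] := eqVneq i j.
    rewrite !mxE; case: (leP 0 (c i 0)) => h.
      by rewrite (_ : Num.max _ 0 = 0) ?mul0r//; apply/max_idPr; rewrite oppr_le0.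
    by rewrite mulr0.
  rewrite mulr_le0_ge0 //; last by rewrite mxE le_max lexx orbT.
  by rewrite mulr_ge0_le0 ?Aoff// mxE le_max lexx orbT.
move: qc; rewrite {2}(posnegE c) bformBr; lra.
Qed.

(** Positivity of the principal submatrix on [F], expressed with vectors of full size so that no
    reindexing occurs later. *)
Definition posdef_on F A :=
  forall c, supported F c -> c != 0 -> 0 < bform A c c.

Lemma posdef_on_ge0 A F c :
  posdef_on F A -> (forall i j, i \in F -> j \in F -> i != j -> A i j <= 0) ->
  supported F c -> (forall i, i \in F -> 0 <= (A *m c) i 0) ->
  forall i, 0 <= c i 0.
Proof.
move=> pA Aoff cF Ac i.
have := negpart_bform_le0 Aoff cF Ac; rewrite leNgt => /negP q0.
have : negpart c = 0.
  apply/eqP/negPn/negP => qn0; apply: q0; apply: pA => // j /cF c0.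
  by rewrite mxE c0 oppr0 maxxx.
move=> /colP/(_ i); rewrite !mxE => h.
by rewrite -oppr_le0 -h le_max lexx.
Qed.

Lemma posdef_on_principal F A : posdefmx (principal_submx F A) -> posdef_on F A.
Proof.
move=> pA c cF c0; pose c' : 'cV[R]_#|F| := \col_k c (enum_val k) 0.
have sumF (f : 'I_m -> R) : (forall i, i \notin F -> f i = 0) ->
    \sum_i f i = \sum_k f (enum_val (A := F) k).
  move=> f0; rewrite -big_enum_val /= [LHS](bigID (mem F)) /=.
  by rewrite [X in _ + X]big1 ?addr0.
have <- : bform (principal_submx F A) c' c' = bform A c c.
  rewrite bform_sumE [RHS]bformE [in RHS]sumF; last first.
    by move=> i /cF ->; apply: big1 => j _; rewrite !mul0r.
  apply: eq_bigr => k _; rewrite [in RHS]sumF; last first.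
    by move=> i /cF ->; rewrite mulr0.
  rewrite !mxE big_distrr; apply: eq_bigr => l _ /=.
  by rewrite !mxE mulrA.
apply: pA; apply: contra_neq c0 => c'0; apply/colP => i; rewrite [RHS]mxE.
have [iF|/cF //] := boolP (i \in F).
have /colP/(_ (enum_rank_in iF i)) := c'0.
by rewrite !mxE enum_rankK_in.
Qed.

End Positivity.

(** * Continuity and a uniform lower bound for positive definite forms *)

Section Compactness.
Context {R : realType}.

Lemma sum_continuous (T : topologicalType) (I : Type) (r : seq I)
    (F : I -> T -> R) :
  (forall i, continuous (F i)) -> continuous (fun x => \sum_(i <- r) F i x).
Proof. by move=> cF; apply: (continuous_big (@add_continuous _)) => i _. Qed.

Lemma mulmx_entry_continuous m p q (A : 'M[R]_(m, p)) i j :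
  continuous (fun v : 'M[R]_(p, q) => (A *m v) i j).
Proof.
rewrite (_ : (fun v => _) = fun v : 'M[R]_(p, q) => \sum_k A i k * v k j).
  apply: sum_continuous => k v; apply: continuousM; first exact: cst_continuous.
  exact: coord_continuous.
by apply/funext => v; rewrite mxE.
Qed.

Lemma le_mx_norm m p (A : 'M[R]_(m, p)) i j : `|A i j| <= `|A|.
Proof.
by rewrite [leRHS]/Num.norm /= mx_normrE; apply/bigmax_geP; right; exists (i, j).
Qed.

Lemma quadratic_continuous (T : topologicalType) m (A : 'M[R]_m)
    (f : T -> 'cV[R]_m) :
  (forall i, continuous (fun x => f x i 0)) ->
  continuous (fun x => bform A (f x) (f x)).
Proof.
move=> cf; rewrite (_ : (fun x => _) =
    fun x => \sum_i \sum_j f x i 0 * A i j * f x j 0); last first.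
  by apply/funext => x; rewrite bformE.
apply: sum_continuous => i; apply: sum_continuous => j x.
apply: (@continuousM R T (fun x => f x i 0 * A i j) (fun x => f x j 0)).
  apply: (@continuousM R T (fun x => f x i 0) (fun=> A i j)); first exact: cf.
  exact: cst_continuous.
exact: cf.
Qed.

(** By homogeneity it suffices to take for [mu] the minimum of the form on the compact unit sphere
    of the coordinate subspace. Transposes appear because [EVT_min_rV] speaks of row vectors. *)
Lemma posdef_on_lower_bound m (A : 'M[R]_m) (F : {set 'I_m}) :
  posdef_on F A -> exists2 mu : R, 0 < mu &
    forall c, supported F c -> forall i, mu * (c i 0) ^+ 2 <= bform A c c.
Proof.
move=> pA; pose S := [set v : 'rV[R]_m | `|v| = 1 /\ supported F v^T].
pose f (v : 'rV[R]_m) := bform A v^T v^T.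
have cf : continuous f.
  apply: (@quadratic_continuous _ _ _ (fun v : 'rV[R]_m => v^T)) => i.
  rewrite (_ : (fun v => _) = fun v : 'rV[R]_m => v 0 i).
    exact: coord_continuous.
  by apply/funext => v; rewrite mxE.
have scale (c : 'cV[R]_m) : supported F c -> c != 0 ->
    S (`|c^T|^-1 *: c^T) /\ bform A c c = `|c^T| ^+ 2 * f (`|c^T|^-1 *: c^T).
  move=> cF c0; have c1 : `|c^T| != 0 by rewrite normr_eq0 trmx_eq0.
  split; last first.
    rewrite /f linearZ /= trmxK bformZl bformZr.
    by move: c1; set a := `|_| => a0; field.
  split; first by rewrite normrZ normfV normr_id mulVf.
  by move=> i /cF h; rewrite !mxE h mulr0.
(* The sphere is empty when only 0 is supported in [F]; any [mu] works then. *)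
have [S0|/nonemptyPn S0] := pselect (S !=set0); last first.
  exists 1 => // c cF i; have [->|c0] := eqVneq c 0.
    by rewrite mxE expr0n mulr0 /bform mulmx0 mxE.
  by have [] := scale c cF c0; rewrite S0.
have cS : compact S.
  apply: bounded_closed_compact.
    exists 1; split; first exact: num_real.
    by move=> x x1 v [v1 _] /=; rewrite v1 ltW.
  rewrite (_ : S = (fun v : 'rV[R]_m => `|v|) @^-1` [set 1] `&`
      \bigcap_(i in [set i | i \notin F]) ((fun v : 'rV[R]_m => v 0 i) @^-1` [set 0])).
    apply: closedI.
      apply: preimage_closed; last exact: closed_eq.
      by move=> v _; exact: norm_continuous.
    apply: closed_bigI => i _; apply: preimage_closed; last exact: closed_eq.
    by move=> v _; exact: coord_continuous.
  apply/seteqP; split=> v [v1 vF]; split=> // i /vF /=; by rewrite mxE.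
have [v0] := EVT_min_rV S0 cS (continuous_subspaceT cf).
rewrite inE => -[v01 v0F] fmin; exists (f v0).
  apply: pA => //; rewrite trmx_eq0 -normr_eq0 v01; exact: oner_neq0.
move=> c cF i; have [->|c0] := eqVneq c 0.
  by rewrite mxE expr0n mulr0 /bform mulmx0 mxE.
have [Sc ->] := scale c cF c0; rewrite mulrC.
apply: ler_pM; rewrite ?sqr_ge0//.
- apply: ltW; apply: pA => //; rewrite trmx_eq0 -normr_eq0 v01; exact: oner_neq0.
- rewrite -real_normK ?num_real// lerXn2r ?nnegrE//.
  by rewrite (le_trans _ (le_mx_norm _ 0 i))// mxE.
- by apply: fmin; rewrite inE.
Qed.

End Compactness.

(** * The hyperboloid and the simplex of a hyperbolic diagram *)

Section Hyperboloid.
Context {R : realType} {n : nat}.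
Implicit Types (u v w : 'cV[R]_n.+1) (x y : hyp R n).

Lemma lorentz_bform v w : lorentz v w = bform (diag_refl R n) v w.
Proof. by []. Qed.

Lemma diag_refl_sym : (diag_refl R n)^T = diag_refl R n.
Proof. exact: tr_diag_mx. Qed.

Lemma lorentzC v w : lorentz v w = lorentz w v.
Proof. exact: bformC diag_refl_sym. Qed.

Lemma lorentzE v w : lorentz v w =
  - (v 0 0 * w 0 0) + \sum_(i < n) v (lift ord0 i) 0 * w (lift ord0 i) 0.
Proof.
rewrite lorentz_bform bform_sumE big_ord_recl /=; congr (_ + _).
  rewrite mxE (bigD1 0) //= big1 ?addr0; last first.
    by move=> j j0; rewrite mxE eq_sym (negPf j0) mulr0n mul0r.
  by rewrite !mxE eqxx mulr1n mulN1r mulrN.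
apply: eq_bigr => i _; congr (_ * _).
rewrite mxE (bigD1 (lift ord0 i)) //= big1 ?addr0; last first.
  by move=> j j0; rewrite mxE eq_sym (negPf j0) mulr0n mul0r.
by rewrite !mxE eqxx mulr1n /= mul1r.
Qed.

(** The future cone. Working in it postpones normalization: sums and positive multiples stay inside,
    and each ray meets the hyperboloid once. *)
Definition timelike v := lorentz v v < 0 /\ 0 < v 0 0.

Lemma hyp_timelike x : timelike (hyp_vec x).
Proof.
have /set_mem[e ?] := valP x; split=> //.
by rewrite [X in X < _]e oppr_cp0 ltr01.
Qed.

Lemma hyp_lorentz x : lorentz (hyp_vec x) (hyp_vec x) = -1.
Proof. by have /set_mem[] := valP x. Qed.

Lemma lorentz_timelike v w : timelike v -> timelike w -> lorentz v w < 0.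
Proof.
case=> vv v0 [ww w0]; move: vv ww; rewrite !lorentzE.
set a := v 0 0 in v0 *; set b := w 0 0 in w0 *.
set S := \sum_(i < n) _; set T := \sum_(i < n) _; set U := \sum_(i < n) _.
move=> vv ww.
(* AM-GM: [2 a b v_k w_k <= b^2 v_k^2 + a^2 w_k^2] *)
have : 2 * (a * b) * U <= b ^+ 2 * S + a ^+ 2 * T.
  rewrite !mulr_sumr -big_split /=; apply: ler_sum => i _.
  set p := v _ _; set q := w _ _; rewrite -subr_ge0.
  by rewrite (_ : _ - _ = (b * p - a * q) ^+ 2) ?sqr_ge0//; ring.
have S1 : b ^+ 2 * S < b ^+ 2 * (a * a) by rewrite ltr_pM2l ?exprn_gt0//; lra.
have T1 : a ^+ 2 * T < a ^+ 2 * (b * b) by rewrite ltr_pM2l ?exprn_gt0//; lra.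
move=> H; have : (a * b) * U < (a * b) * (a * b) by lra.
by rewrite ltr_pM2l ?mulr_gt0//; lra.
Qed.

Lemma timelikeZ c v : 0 < c -> timelike v -> timelike (c *: v).
Proof.
move=> c0 [vv v0]; split; last by rewrite mxE mulr_gt0.
by rewrite lorentz_bform bformZl bformZr !pmulr_rlt0.
Qed.

Lemma timelikeD v w : timelike v -> timelike w -> timelike (v + w).
Proof.
move=> tv tw; have vw := lorentz_timelike tv tw.
case: tv tw => vv v0 [ww w0]; split; last by rewrite mxE addr_gt0.
rewrite lorentz_bform bformDl !bformDr -!lorentz_bform (lorentzC w v); lra.
Qed.

Definition unit_scale v := (Num.sqrt (- lorentz v v))^-1.

Lemma unit_scale_gt0 v : timelike v -> 0 < unit_scale v.
Proof. by case=> vv _; rewrite invr_gt0 sqrtr_gt0 oppr_gt0. Qed.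

Lemma normalize_subproof v : timelike v -> unit_scale v *: v \in
  [set x : 'cV[R]_n.+1 | lorentz x x = -1 /\ 0 < x 0 0].
Proof.
move=> tv; have [vv v0] := timelikeZ (unit_scale_gt0 tv) tv.
rewrite inE; split=> //; rewrite lorentz_bform bformZl bformZr mulrA -expr2.
case: tv => vv0 _; rewrite exprVn sqr_sqrtr ?oppr_ge0 ?ltW//.
by rewrite invrN mulNr mulVf// lt_eqF.
Qed.

Definition normalize v (tv : timelike v) : hyp R n :=
  exist (fun w => w \in [set x : 'cV[R]_n.+1 | lorentz x x = -1 /\ 0 < x 0 0])
    _ (normalize_subproof tv).

Lemma normalizeE v (tv : timelike v) : hyp_vec (normalize tv) = unit_scale v *: v.
Proof. by []. Qed.

Lemma hyp_vec_inj : injective (@hyp_vec R n).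
Proof. exact: val_inj. Qed.

Lemma hyp_vec_continuous : continuous (@hyp_vec R n).
Proof. exact: initial_continuous. Qed.

Lemma lorentz_hyp_continuous w : continuous (fun x => lorentz (hyp_vec x) w).
Proof.
rewrite (_ : (fun x => _) =
    (fun v => ((diag_refl R n *m w)^T *m v) 0 0) \o @hyp_vec R n).
  move=> x; apply: continuous_comp; first exact: hyp_vec_continuous.
  exact: mulmx_entry_continuous.
apply/funext => x /=.
by rewrite lorentzC /lorentz trmx_mul diag_refl_sym.
Qed.

Section Path.
Context (x y : hyp R n).

(** The absolute values change nothing on [0, 1], but keep the vector timelike for every real [t],
    so that the normalized path is continuous on the whole line. *)
Definition hyp_path_vec (t : R) : 'cV[R]_n.+1 :=
  `|1 - t| *: hyp_vec x + `|t| *: hyp_vec y.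

Lemma hyp_path_timelike t : timelike (hyp_path_vec t).
Proof.
have tx := hyp_timelike x; have ty := hyp_timelike y; rewrite /hyp_path_vec.
have [->|t0] := eqVneq t 0.
  by rewrite normr0 scale0r addr0 subr0 normr1 scale1r.
have [->|t1] := eqVneq t 1.
  by rewrite subrr normr0 scale0r add0r normr1 scale1r.
by apply: timelikeD; apply: timelikeZ => //; rewrite normr_gt0// subr_eq0 eq_sym.
Qed.

Definition hyp_path (t : R) : hyp R n := normalize (hyp_path_timelike t).

Lemma hyp_path_vec_continuous : continuous hyp_path_vec.
Proof.
move=> t; apply: cvgD; apply: cvgZr_tmp; apply: cvg_norm.
  by apply: cvgB; [exact: cvg_cst|exact: cvg_id].
exact: cvg_id.
Qed.

Lemma unit_scale_continuous t : {for t, continuous (unit_scale \o hyp_path_vec)}.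
Proof.
have [vv _] := hyp_path_timelike t.
apply: cvgV; first by rewrite sqrtr_eq0 -ltNge oppr_gt0.
apply: (@continuous_comp _ _ _
  (fun t => - lorentz (hyp_path_vec t) (hyp_path_vec t)) Num.sqrt); last first.
  exact: sqrt_continuous.
apply: cvgN.
apply: (@quadratic_continuous R R n.+1 (diag_refl R n) hyp_path_vec) => i t'.
apply: (@continuous_comp _ _ _ hyp_path_vec (fun v : 'cV[R]_n.+1 => v i 0)).
   exact: hyp_path_vec_continuous.
exact: coord_continuous.
Qed.

Lemma hyp_path_continuous : continuous hyp_path.
Proof.
move=> t; apply: continuous_comp_initial => {}t.
apply: cvgZ; [exact: unit_scale_continuous|exact: hyp_path_vec_continuous].
Qed.
End Path.

(** An open half-space of hyperbolic space is connected: the normalized segment from [x] to [y]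
    stays in it, and a change of sign of [g] along this path would produce a zero. *)
Lemma half_space_sign (w : 'cV[R]_n.+1) (g : hyp R n -> R) (x y : hyp R n) :
  continuous g -> (forall z, lorentz (hyp_vec z) w < 0 -> g z != 0) ->
  lorentz (hyp_vec x) w < 0 -> lorentz (hyp_vec y) w < 0 -> 0 < g x * g y.
Proof.
move=> cg gn0 xw yw.
have path0 : hyp_path x y 0 = x.
  apply: hyp_vec_inj; rewrite normalizeE /hyp_path_vec subr0 normr1 normr0.
  by rewrite scale0r addr0 scale1r /unit_scale hyp_lorentz opprK sqrtr1 invr1 scale1r.
have path1 : hyp_path x y 1 = y.
  apply: hyp_vec_inj; rewrite normalizeE /hyp_path_vec subrr normr1 normr0.
  by rewrite scale0r add0r scale1r /unit_scale hyp_lorentz opprK sqrtr1 invr1 scale1r.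
rewrite ltNge; apply/negP => gg.
have cgp : {within `[0, 1 : R], continuous (g \o hyp_path x y)}.
  apply: continuous_subspaceT => t; apply: continuous_comp; last exact: cg.
  exact: hyp_path_continuous.
have /(IVT ler01 cgp)[t] : Num.min ((g \o hyp_path x y) 0) ((g \o hyp_path x y) 1)
    <= 0 <= Num.max ((g \o hyp_path x y) 0) ((g \o hyp_path x y) 1).
  rewrite /= path0 path1 ge_min le_max.
  have gx0 := gn0 _ xw; have gy0 := gn0 _ yw.
  have [gx|gx] := ltP (g x) 0; have [gy|gy] := ltP (g y) 0.
  - by move: gg; rewrite leNgt nmulr_rgt0 ?gy.
  - by rewrite (ltW gx) orbT.
  - by rewrite (ltW gy) orbT.
  - by move: gg; rewrite leNgt mulr_gt0// lt_neqAle eq_sym ?gx0 ?gy0.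
rewrite in_itv /= => /andP[t0 t1]; apply/eqP; apply: gn0.
rewrite normalizeE lorentz_bform bformZl pmulr_rlt0; last first.
  exact/unit_scale_gt0/hyp_path_timelike.
rewrite bformDl !bformZl -!lorentz_bform !ger0_norm ?subr_ge0//.
have [->|t0'] := eqVneq t 0; first by rewrite subr0 mul1r mul0r addr0.
have tp : 0 < t by rewrite lt_neqAle eq_sym t0'.
have : t * lorentz (hyp_vec y) w < 0 by rewrite pmulr_rlt0.
have : (1 - t) * lorentz (hyp_vec x) w <= 0 by rewrite mulr_ge0_le0 ?subr_ge0// ltW.
lra.
Qed.

End Hyperboloid.

(** * The Lorentz form in the basis of normals *)

Section Reflections.
Context {R : realType} {n : nat} {J : coxeter_diagram n}.
Context (hypJ : hyperbolic R J).
Context (G : hyp_realization R J).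

Definition normals : 'M[R]_n.+1 := \matrix_(i, j) hr_normal G j i 0.

Lemma normals_delta i : normals *m delta_mx i 0 = hr_normal G i.
Proof. by rewrite -colE; apply/colP => j; rewrite !mxE. Qed.

Lemma cartan_sym : (cartan R J)^T = cartan R J.
Proof.
apply/matrixP => i j; rewrite !mxE eq_sym; case: eqVneq => // ij.
by rewrite /cox_angle (cox_m_sym J ij).
Qed.

Lemma normals_gram : normals^T *m diag_refl R n *m normals = cartan R J.
Proof.
apply/matrixP => i j; rewrite -(hr_gram G i j) -bform_delta bform_congr.
by rewrite !normals_delta.
Qed.

(** The Gram matrix of the normals is the Cartan matrix, whose non-degeneracy makes them a basis. *)
Lemma normals_unit : normals \in unitmx.
Proof.
have [Cu _ _] := hypJ; move: Cu; rewrite -normals_gram !unitmxE !det_mulmx.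
by rewrite !unitrM det_tr => /andP[_].
Qed.

Lemma lorentz_normals c d :
  lorentz (normals *m c) (normals *m d) = bform (cartan R J) c d.
Proof. by rewrite -normals_gram bform_congr. Qed.

Lemma lorentz_normal c i :
  lorentz (normals *m c) (hr_normal G i) = (cartan R J *m c) i 0.
Proof.
by rewrite -(normals_delta i) lorentz_normals (bformC _ _ cartan_sym) bform_deltal.
Qed.

Lemma cartan_offdiag_le0 i j : i != j -> cartan R J i j <= 0.
Proof.
move=> ij; rewrite mxE (negPf ij) oppr_le0 /cox_angle.
case e : (J i j) => [k|]; last by rewrite cos0 ler01.
have k2 := cox_m_ge2 ij e.
have k0 : 0 < k%:R :> R by rewrite ltr0n; case: k k2 {e}.
apply: cos_ge0_pihalf; apply/andP; split.
  apply: (@le_trans _ _ 0); first by rewrite oppr_le0 divr_ge0 ?pi_ge0.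
  by rewrite divr_ge0 ?pi_ge0// ltW.
by rewrite ler_pM2l ?pi_gt0// lef_pV2 ?posrE// ler_nat.
Qed.

Lemma cartan_posdef_on (F : {set 'I_n.+1}) :
  F \proper [set: 'I_n.+1]%SET -> posdef_on F (cartan R J).
Proof. by have [_ _ h] := hypJ => /h; exact: posdef_on_principal. Qed.

Definition hact (u : seq 'I_n.+1) : hyp R n -> hyp R n := hr_act G (cox_word J u).

Lemma hact_cat u v x : hact (u ++ v) x = hact u (hact v x).
Proof. by rewrite /hact -cox_mulE [LHS](congr1 (@^~ x) (hr_actM G _ _)). Qed.

Lemma hact_nil x : hact [::] x = x.
Proof. exact: (congr1 (@^~ x) (hr_act1 G)). Qed.

Lemma hact_cons i u x : hyp_vec (hact (i :: u) x) =
  hyp_vec (hact u x) -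
    2 * lorentz (hyp_vec (hact u x)) (hr_normal G i) *: hr_normal G i.
Proof. by rewrite -[i :: u]/([:: i] ++ u) hact_cat hr_act_gen. Qed.

Lemma lorentz_hact u x y :
  lorentz (hyp_vec (hact u x)) (hyp_vec (hact u y)) =
  lorentz (hyp_vec x) (hyp_vec y).
Proof.
elim: u => [|i u <-]; first by rewrite !hact_nil.
rewrite !hact_cons; set a := hyp_vec _; set b := hyp_vec _.
rewrite !lorentz_bform !bformBl !bformBr !bformZl !bformZr -!lorentz_bform.
have e : lorentz (hr_normal G i) (hr_normal G i) = 1 by rewrite hr_gram mxE eqxx.
by rewrite e (lorentzC (hr_normal G i) b); ring.
Qed.

End Reflections.

(** * Finiteness of the proper parabolic subgroups *)

Section FiniteParabolic.
Context {R : realType} {n : nat} {J : coxeter_diagram n}.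
Context (hypJ : hyperbolic R J) (G : hyp_realization R J).

Lemma hyp_inhabited : inhabited (hyp R n).
Proof.
have t0 : timelike (delta_mx 0 0 : 'cV[R]_n.+1).
  split; last by rewrite mxE ltr01.
  by rewrite lorentz_bform bform_delta !mxE eqxx mulr1n oppr_cp0 ltr01.
by split; exact: normalize t0.
Qed.

(** Invertibility of the Cartan matrix gives a vector [w] with product -1 with all normals. The
    covering provides a point of the simplex, and a small push of it along [w] makes all
    inequalities strict. *)
Lemma interior_point :
  exists x : hyp R n, forall i, lorentz (hyp_vec x) (hr_normal G i) < 0.
Proof.
have [p] := hyp_inhabited.
have : (\bigcup_g (hr_act G g @` hr_simplex G)) p by rewrite hr_cover.
case=> _ _ [q qS _].
pose w : 'cV[R]_n.+1 := normals G *m (invmx (cartan R J) *m const_mx (-1)).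
have Cu : cartan R J \in unitmx by case: hypJ.
have wi i : lorentz w (hr_normal G i) = -1.
  by rewrite /w lorentz_normal mulKVmx// mxE.
have [qq q0] := hyp_timelike q; rewrite hyp_lorentz in qq.
set v := hyp_vec q in qq q0.
(* With e = 1/K, the summands of e K = 1 control, in turn, the cross term and the square of e w in
   the Lorentz norm, and the loss in the time coordinate; the summand 1 gives e <= 1 and
   strictness. *)
pose K := 1 + `|2 * lorentz v w| + `|lorentz w w| + `|w 0 0| / v 0 0.
have K0 : 0 <= `|w 0 0| / v 0 0 by rewrite divr_ge0// ltW.
have K1 : 0 < K.
  have := normr_ge0 (2 * lorentz v w); have := normr_ge0 (lorentz w w).
  rewrite /K; lra.
pose e := K^-1.
have e0 : 0 < e by rewrite invr_gt0.
have eK : e * K = 1 by rewrite mulVf// gt_eqF.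
have t : timelike (v + e *: w).
  split.
    rewrite lorentz_bform bformDl !bformDr !bformZl !bformZr -!lorentz_bform.
    rewrite /v hyp_lorentz -/v (lorentzC w v).
    have e1 : e <= 1.
      rewrite invf_le1// /K.
      have := normr_ge0 (2 * lorentz v w); have := normr_ge0 (lorentz w w); lra.
    have H1 : e * (2 * lorentz v w) <= e * `|2 * lorentz v w|.
      by rewrite ler_pM2l// ler_norm.
    have H2 : e * (e * lorentz w w) <= e * `|lorentz w w|.
      rewrite ler_pM2l//; apply: (le_trans (ler_norm _)).
      by rewrite normrM gtr0_norm// ler_piMl.
    move: eK; rewrite /K !mulrDr.
    have : 0 <= e * (`|w 0 0| / v 0 0) by rewrite mulr_ge0// ltW.
    lra.
  rewrite mxE [X in _ + X]mxE; have H : - (e * w 0 0) <= e * `|w 0 0|.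
    by rewrite -mulrN ler_pM2l// -normrN ler_norm.
  suff : e * `|w 0 0| < v 0 0 by lra.
  have -> : e * `|w 0 0| = (e * (`|w 0 0| / v 0 0)) * v 0 0.
    by rewrite -!mulrA mulVf ?mulr1// gt_eqF.
  rewrite -[ltRHS]mul1r ltr_pM2r// -eK ltr_pM2l// /K.
  have := normr_ge0 (2 * lorentz v w); have := normr_ge0 (lorentz w w); lra.
exists (normalize t) => i.
rewrite normalizeE lorentz_bform bformZl pmulr_rlt0 ?unit_scale_gt0//.
rewrite bformDl bformZl -!lorentz_bform wi.
have /= := qS i; rewrite -/v; lra.
Qed.

Lemma strict_simplex_interior (x : hyp R n) :
  (forall i, lorentz (hyp_vec x) (hr_normal G i) < 0) -> (hr_simplex G)° x.
Proof.
move=> xi; have : \forall y \near x, forall i, lorentz (hyp_vec y) (hr_normal G i) < 0.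
  apply: (@filter_forall _ _
    (fun j (y : hyp R n) => lorentz (hyp_vec y) (hr_normal G j) < 0) (nbhs x) _) => j.
  apply: (@lorentz_hyp_continuous _ _ (hr_normal G j) x [set t : R | t < 0]).
  by apply: open_nbhs_nbhs; split; [exact: open_lt|exact: xi].
by apply: filterS => y yi i; exact: ltW.
Qed.

Context (F : {set 'I_n.+1}) (Fp : F \proper [set: 'I_n.+1]%SET).
Context (x0 : hyp R n).
Context (x0i : forall i, lorentz (hyp_vec x0) (hr_normal G i) < 0).

(* Bounded by positive definiteness and uniformly separated by the tiling, the
   orbit of [x0] is finite. *)
Definition orbit_coord (u : seq 'I_n.+1) : 'cV[R]_n.+1 :=
  invmx (normals G) *m (hyp_vec (hact G u x0) - hyp_vec x0).

Lemma orbit_coordK u :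
  normals G *m orbit_coord u = hyp_vec (hact G u x0) - hyp_vec x0.
Proof. by rewrite mulKVmx// normals_unit. Qed.

(** Each letter adds a multiple of its own normal, so the displacement of [x0] stays in the span of
    the normals of [F], where the form is positive definite. *)
Lemma orbit_coord_supported u : all (mem F) u -> supported F (orbit_coord u).
Proof.
elim: u => [|i u ih] /=.
  by move=> _ j _; rewrite /orbit_coord hact_nil subrr mulmx0 mxE.
case/andP=> iF /ih {}ih j jF.
rewrite /orbit_coord hact_cons addrAC mulmxDr mulmxN -scalemxAr.
rewrite -(normals_delta G i) mulKmx ?normals_unit//.
rewrite mxE [X in X + _](ih j jF) !mxE add0r.
have -> : (j == i) = false by apply: contraNF jF => /eqP ->.
by rewrite mulr0 oppr0.
Qed.

Lemma lorentz_normalsr (v c : 'cV[R]_n.+1) :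
  lorentz v (normals G *m c) = \sum_j lorentz v (hr_normal G j) * c j 0.
Proof.
rewrite /lorentz mulmxA mxE; apply: eq_bigr => j _; congr (_ * _).
by rewrite -normals_delta mulmxA -colE [RHS]mxE.
Qed.

Let Q := bform (cartan R J).

(** [x0] and its image have the same Lorentz norm, so the square of the displacement [c] is linear
    in [c]. Comparing it with [mu] times the square of the largest coordinate bounds that
    coordinate. *)
Lemma orbit_coord_bounded : exists M, forall u, all (mem F) u ->
  forall i, `|orbit_coord u i 0| <= M.
Proof.
have [mu mu0 muQ] := posdef_on_lower_bound (cartan_posdef_on hypJ Fp).
pose K := \sum_i `|lorentz (hyp_vec x0) (hr_normal G i)|.
have K0 : 0 <= K by exact: sumr_ge0.
exists (2 * K / mu) => u uF i.
set c := orbit_coord u.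
have Qc : Q c c = - (2 * lorentz (hyp_vec x0) (normals G *m c)).
  rewrite /Q -(lorentz_normals G).
  have := hyp_lorentz (hact G u x0).
  have -> : hyp_vec (hact G u x0) = hyp_vec x0 + normals G *m c.
    by rewrite orbit_coordK addrC subrK.
  rewrite lorentz_bform bformDl !bformDr -!lorentz_bform hyp_lorentz.
  by rewrite (lorentzC (_ *m _) (hyp_vec x0)); lra.
have [j _ jmax] := @arg_maxP _ _ 'I_n.+1 0 xpredT (fun j => `|c j 0|) isT.
suff : `|c j 0| <= 2 * K / mu by apply: le_trans; exact: jmax.
have [->|cj0] := eqVneq (c j 0) 0.
  by rewrite normr0 divr_ge0 ?(ltW mu0)// !mulr_ge0.
have cj : 0 < `|c j 0| by rewrite normr_gt0.
rewrite ler_pdivlMr// mulrC -(ler_pM2l cj) [leLHS]mulrCA -expr2 real_normK ?num_real//.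
apply: le_trans (muQ c (orbit_coord_supported uF) j) _.
rewrite -/(Q c c) Qc lorentz_normalsr -mulrN mulrCA ler_pM2l//.
rewrite -sumrN mulr_sumr; apply: ler_sum => k _.
apply: le_trans (ler_norm _) _; rewrite normrN normrM mulrC.
by rewrite ler_wpM2r//; exact: jmax.
Qed.

(** By invariance, the separation of two orbit points reduces to that of [x0] and one orbit point;
    [rev u] represents the inverse of [u]. *)
Lemma orbit_coord_bform u v :
  Q (orbit_coord u - orbit_coord v) (orbit_coord u - orbit_coord v) =
  Q (orbit_coord (rev u ++ v)) (orbit_coord (rev u ++ v)).
Proof.
rewrite /Q -!(lorentz_normals G) !mulmxBr !orbit_coordK.
have -> (a b c : 'cV[R]_n.+1) : a - c - (b - c) = a - b by rewrite opprB addrA subrK.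
set a := hact G u x0; set b := hact G v x0.
rewrite !lorentz_bform !bformBl !bformBr -!lorentz_bform !hyp_lorentz.
rewrite (lorentzC (hyp_vec x0)) (lorentzC (hyp_vec b) (hyp_vec a)).
have -> : lorentz (hyp_vec (hact G (rev u ++ v) x0)) (hyp_vec x0) =
    lorentz (hyp_vec a) (hyp_vec b).
  have {2}-> : x0 = hact G (rev u) a.
    rewrite -hact_cat /hact (_ : cox_word J _ = 1%g) ?hr_act1//.
    exact/cox_wordP/cox_eq_rev.
  by rewrite hact_cat lorentz_hact lorentzC.
by [].
Qed.

(** A nontrivial element moves [x0] out of the open simplex, hence across some wall: its product
    with a normal rises from at most [- d0] to at least 0. Here [d0] is attained at the wall for
    which this product is closest to 0, and [K] exceeds the absolute row sums of the Cartan matrix,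
    so some coordinate is at least [d0 / K]. *)
Lemma orbit_coord_separated : exists2 d : R, 0 < d & forall u,
  cox_word J u != 1%g -> exists i, d <= `|orbit_coord u i 0|.
Proof.
have [k _ kmax] := @arg_maxP _ _ 'I_n.+1 0 xpredT
  (fun j => lorentz (hyp_vec x0) (hr_normal G j)) isT.
pose d0 := - lorentz (hyp_vec x0) (hr_normal G k).
have d00 : 0 < d0 by rewrite oppr_gt0.
pose K := 1 + \sum_i \sum_j `|cartan R J i j|.
have K0 : 0 < K.
  by rewrite ltr_wpDr// sumr_ge0// => i _; exact: sumr_ge0.
exists (d0 / K); first exact: divr_gt0.
move=> u u1.
have [i ui] : exists i, 0 <= lorentz (hyp_vec (hact G u x0)) (hr_normal G i).
  apply/not_existsP => uneg.
  have /seteqP[/(_ (hact G u x0)) + _] := hr_disjoint G u1.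
  apply; split.
    by apply: strict_simplex_interior => i; rewrite ltNge; apply/negP/uneg.
  by exists x0 => //; exact: strict_simplex_interior.
apply/not_existsP => small.
have {}small j : `|orbit_coord u j 0| < d0 / K by rewrite ltNge; apply/negP/small.
have H : d0 <= (cartan R J *m orbit_coord u) i 0.
  rewrite -(lorentz_normal G) orbit_coordK lorentz_bform bformBl -!lorentz_bform.
  have := kmax i isT; rewrite /d0 /=; lra.
have : (cartan R J *m orbit_coord u) i 0 <= (K - 1) * (d0 / K).
  rewrite /K addrC addKr mxE mulr_suml.
  apply: (@le_trans _ _ (\sum_j `|cartan R J i j| * (d0 / K))).
    apply: ler_sum => j _; apply: le_trans (ler_norm _) _.
    by rewrite normrM ler_wpM2l// ltW.
  rewrite [leRHS](bigD1 i) //= mulr_suml lerDl.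
  apply: sumr_ge0 => j _; apply: mulr_ge0; first exact: sumr_ge0.
  by rewrite divr_ge0 ?ltW.
have : (K - 1) * (d0 / K) < d0.
  rewrite mulrBl mul1r mulrC divfK ?gt_eqF//.
  by rewrite ltrBlDr ltrDl divr_gt0.
lra.
Qed.

(** If [rev u ++ v] were nontrivial, separation would make the square of the difference of
    coordinates at least [mu * d ^+ 2], which is too large for close coordinates. *)
Lemma orbit_coord_close : exists2 e : R, 0 < e & forall u v,
  all (mem F) u -> all (mem F) v ->
  (forall i, `|orbit_coord u i 0 - orbit_coord v i 0| < e) -> cox_eq J u v.
Proof.
have [mu mu0 muQ] := posdef_on_lower_bound (cartan_posdef_on hypJ Fp).
have [d d0 sep] := orbit_coord_separated.
pose K := 1 + \sum_i \sum_j `|cartan R J i j|.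
have K1 : 1 <= K.
  by rewrite lerDl sumr_ge0// => i _; exact: sumr_ge0.
(* The bound 1 allows e^2 <= e, so that the form, at most (K - 1) e^2, is less than mu d^2. *)
pose e := Num.min 1 (mu * d ^+ 2 / K).
have K0 : 0 < K by lra.
exists e; first by rewrite lt_min ltr01 divr_gt0// mulr_gt0// exprn_gt0.
move=> u v uF vF close.
suff : cox_word J (rev u ++ v) = 1%g.
  move=> h; apply/cox_wordP.
  have uV : cox_word J (u ++ rev u) = 1%g.
    by apply/cox_wordP; rewrite -{1}(revK u); exact: cox_eq_rev.
  have mulE (a b : seq 'I_n.+1) : cox_word J (a ++ b) = (cox_word J a * cox_word J b)%g.
    by rewrite -[LHS]cox_mulE.
  move: h uV; rewrite !mulE => h uV.
  by rewrite -[LHS]mulg1 -h mulgA uV mul1g.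
apply/eqP/negPn/negP => /sep[i di].
have wF : all (mem F) (rev u ++ v) by rewrite all_cat all_rev uF.
have := muQ _ (orbit_coord_supported wF) i.
rewrite -/(Q _ _) -orbit_coord_bform.
set c := orbit_coord u - orbit_coord v.
have ce j : `|c j 0| < e by rewrite mxE [X in _ + X]mxE; exact: close.
have e1 : e <= 1 by rewrite ge_min lexx.
have e0 : 0 <= e by exact: ltW (le_lt_trans (normr_ge0 _) (ce 0)).
have : Q c c <= (K - 1) * e.
  rewrite /Q bformE /K addrC addKr mulr_suml; apply: ler_sum => j _.
  rewrite mulr_suml; apply: ler_sum => k _; apply: le_trans (ler_norm _) _.
  rewrite !normrM mulrAC mulrC ler_wpM2l//.
  rewrite -[leRHS]mulr1; apply: ler_pM => //; first exact: ltW.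
  by apply: ltW; apply: lt_le_trans e1.
have : (K - 1) * e < mu * d ^+ 2.
  apply: (@lt_le_trans _ _ (K * e)).
    have [e_gt0|] := ltP 0 e; first by rewrite ltr_pM2r//; lra.
    have : 0 < e by rewrite lt_min ltr01 divr_gt0// mulr_gt0// exprn_gt0.
    by move=> h1; rewrite leNgt h1.
  by rewrite mulrC -ler_pdivlMr// ge_min lexx orbT.
have : mu * d ^+ 2 <= mu * orbit_coord (rev u ++ v) i 0 ^+ 2.
  rewrite ler_pM2l// -(@real_normK _ (orbit_coord _ _ _)) ?num_real//.
  by rewrite lerXn2r// nnegrE ltW.
lra.
Qed.

End FiniteParabolic.

(** Only words and their congruence occur, so that the bound can be chosen independently of all
    geometric data. *)
Definition words_bounded n (J : coxeter_diagram n) (F : {set 'I_n.+1}) N :=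
  forall u, all (mem F) u ->
    exists v, [/\ all (mem F) v, (size v <= N)%N & cox_eq J u v].

(** Pigeonhole: cut the box of side 2 M into cubes of side [e]. Words in the same cube are
    congruent, so one chosen word per nonempty cube suffices; [rep] is [[::]] on cubes reached by no
    word. *)
Lemma words_bounded_of_coord (R : realType) n (J : coxeter_diagram n)
    (F : {set 'I_n.+1}) (c : seq 'I_n.+1 -> 'cV[R]_n.+1) (M e : R) :
  0 < e ->
  (forall u, all (mem F) u -> forall i, `|c u i 0| <= M) ->
  (forall u v, all (mem F) u -> all (mem F) v ->
    (forall i, `|c u i 0 - c v i 0| < e) -> cox_eq J u v) ->
  exists N, words_bounded J F N.
Proof.
move=> e0 cM ce.
pose K := Num.truncn (2 * M / e).
pose key u : {ffun 'I_n.+1 -> 'I_K.+1} :=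
  [ffun i => inord (Num.truncn ((c u i 0 + M) / e))].
have keyP u : all (mem F) u -> forall i,
    (key u i)%:R * e <= c u i 0 + M < (key u i).+1%:R * e.
  move=> uF i; rewrite ffunE inordK.
    rewrite -ler_pdivlMr// -ltr_pdivrMr//; apply: truncn_itv.
    by rewrite divr_ge0 ?(ltW e0)//; have := cM u uF i; rewrite ler_norml; lra.
  rewrite ltnS; apply: le_truncn.
  by rewrite ler_pM2r ?invr_gt0//; have := cM u uF i; rewrite ler_norml; lra.
pose P phi u := all (mem F) u /\ key u = phi.
pose rep phi := if pselect (exists u, P phi u) is left h then projT1 (cid h) else [::].
exists (\max_phi size (rep phi)) => u uF; exists (rep (key u)).
have [vF vu] : P (key u) (rep (key u)).
  rewrite /rep; case: pselect => [h|]; first by case: cid.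
  by case; exists u.
split=> //; first exact: leq_bigmax.
apply: ce => // i; have := keyP u uF i; have := keyP _ vF i; rewrite vu.
rewrite -!natr1 ltr_norml !mulrDl mul1r; lra.
Qed.

(** [N] is quantified before the realization; if there is no realization, any value does. The
    maximum over all [F] serves every cell at once. *)
Lemma parabolic_words_bounded (R : realType) n (J : coxeter_diagram n) :
  hyperbolic R J -> exists N, inhabited (hyp_realization R J) ->
    forall F : {set 'I_n.+1}, F \proper [set: 'I_n.+1]%SET -> words_bounded J F N.
Proof.
move=> hypJ; have [[G]|noG] := pselect (inhabited (hyp_realization R J));
  last by exists 0%N.
have [x0 x0i] := interior_point hypJ G.
have bound (F : {set 'I_n.+1}) : exists N,
    F \proper [set: 'I_n.+1]%SET -> words_bounded J F N.
  have [Fp|_] := boolP (F \proper [set: 'I_n.+1]%SET); last by exists 0%N.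
  have [M cM] := orbit_coord_bounded hypJ G Fp x0.
  have [e e0 ce] := orbit_coord_close hypJ Fp x0i.
  by have [N HN] := words_bounded_of_coord e0 cM ce; exists N.
have [N HN] := choice bound.
exists (\max_(F : {set 'I_n.+1}) N F) => _ F Fp u /(HN F Fp)[v [vF vN uv]].
by exists v; split=> //; apply: leq_trans vN _; exact: leq_bigmax.
Qed.

(** * Projective space *)

Section Representatives.
Context {R : realType} {n : nat}.
Local Notation P := (proj_space R n).
Implicit Types (x y : P) (v w : 'cV[R]_n.+1) (M : 'M[R]_n.+1) (g h : PGL R n).

(** Arbitrary homogeneous coordinates of [x]; the choice made by [repr] is hidden behind this
    relation, as it is for matrices behind [reps]. *)
Definition isrep v x := exists2 c : R, c != 0 & v = c *: proj_vec x.

Lemma nzvec_neq0 (v : nzvec R n) : set_val v != 0 :> 'cV[R]_n.+1.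
Proof. by have /set_mem := valP v. Qed.

Lemma proj_vec_neq0 x : proj_vec x != 0.
Proof. exact: nzvec_neq0. Qed.

Lemma isrep_proj_vec x : isrep (proj_vec x) x.
Proof. by exists 1; rewrite ?oner_neq0 ?scale1r. Qed.

Lemma isrep_neq0 v x : isrep v x -> v != 0.
Proof. by case=> c c0 ->; rewrite scaler_eq0 negb_or c0 proj_vec_neq0. Qed.

Lemma isrepZ c v x : c != 0 -> isrep v x -> isrep (c *: v) x.
Proof.
by move=> c0 [d d0 ->]; exists (c * d); rewrite ?mulf_neq0// scalerA.
Qed.

Lemma isrep_colinear v w x : isrep v x -> isrep w x ->
  exists2 c : R, c != 0 & w = c *: v.
Proof.
move=> [c c0 ->] [d d0 ->]; exists (d / c); first by rewrite mulf_neq0 ?invr_neq0.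
by rewrite scalerA divfK.
Qed.

Lemma proj_ptP (u v : nzvec R n) : proj_pt u = proj_pt v <->
  exists2 c : R, c != 0 & set_val u = c *: set_val v.
Proof.
split=> [/(@eqmodP _ (colinear_equiv_rel R n))/asboolP //|uv].
by apply/(@eqmodP _ (colinear_equiv_rel R n))/asboolP.
Qed.

Lemma proj_reprK x : proj_pt (repr x) = x.
Proof. exact: (@reprK _ P x). Qed.

Lemma isrep_proj_pt (v : nzvec R n) : isrep (set_val v) (proj_pt v).
Proof.
have /proj_ptP[c c0 e] := proj_reprK (proj_pt v).
exists c^-1; first by rewrite invr_neq0.
by rewrite /proj_vec [set_val (repr _)]e scalerA mulVf// scale1r.
Qed.

Lemma isrep_inj v x y : isrep v x -> isrep v y -> x = y.
Proof.
move=> [c c0 ->] [d d0 e]; rewrite -(proj_reprK x) -(proj_reprK y); apply/proj_ptP.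
exists (c^-1 * d); first by rewrite mulf_neq0 ?invr_neq0.
by rewrite -scalerA -[d *: _]e scalerA mulVf// scale1r.
Qed.

Definition nz v (v0 : v != 0) : nzvec R n :=
  exist (fun v => v \in [set v : 'cV[R]_n.+1 | v != 0]) v (mem_set v0).

Lemma isrep_nz v (v0 : v != 0) : isrep v (proj_pt (nz v0)).
Proof. exact: (isrep_proj_pt (nz v0)). Qed.

Lemma isrep_exists v : v != 0 -> exists x, isrep v x.
Proof. by move=> v0; exists (proj_pt (nz v0)); exact: isrep_nz. Qed.

Definition reps M g := exists2 c : R, c != 0 & M = c *: val (repr g).

Lemma reps_repr g : reps (val (repr g)) g.
Proof. by exists 1; rewrite ?oner_neq0 ?scale1r. Qed.

Lemma reps_pgl (A : GL R n) : reps (val A) (pgl A).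
Proof.
have /pglP[c c0 e] := pgl_reprK (pgl A).
by exists c^-1; rewrite ?invr_neq0// e scalerA mulVf// scale1r.
Qed.

Lemma repsZ c M g : c != 0 -> reps M g -> reps (c *: M) g.
Proof.
by move=> c0 [d d0 ->]; exists (c * d); rewrite ?mulf_neq0// scalerA.
Qed.

Lemma reps_proportional M M' g : reps M g -> reps M' g ->
  exists2 c : R, c != 0 & M' = c *: M.
Proof.
move=> [c c0 ->] [d d0 ->]; exists (d / c); first by rewrite mulf_neq0 ?invr_neq0.
by rewrite scalerA divfK.
Qed.

Lemma repsM M M' g h : reps M g -> reps M' h -> reps (M *m M') (g * h)%g.
Proof.
move=> [c c0 ->] [d d0 ->]; rewrite -scalemxAl -scalemxAr scalerA.
by apply: repsZ; rewrite ?mulf_neq0//; exact: (reps_pgl (GL_mul _ _)).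
Qed.

Lemma reps1 : reps 1%:M 1%g.
Proof. exact: (reps_pgl (GL_one R n)). Qed.

Lemma isrep_act M g v x : reps M g -> isrep v x -> isrep (M *m v) (pgl_act g x).
Proof.
move=> [c c0 ->] [d d0 ->]; rewrite -scalemxAl -scalemxAr scalerA.
apply: isrepZ; rewrite ?mulf_neq0//.
exact: (isrep_proj_pt (GL_act (repr g) (repr x))).
Qed.

Lemma pgl_act1 x : pgl_act 1%g x = x.
Proof.
apply: isrep_inj (isrep_act reps1 (isrep_proj_vec x)) _.
by rewrite mul1mx; exact: isrep_proj_vec.
Qed.

Lemma cellP (B : GL R n) (S : {set 'I_n.+1}) x : cell B S x <->
  exists c : 'cV[R]_n.+1, [/\ forall i, 0 <= c i 0, supported S c &
    isrep (val B *m c) x].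
Proof.
split=> [[v [c [c0 cS e]] <-]|[c [c0 cS vx]]].
  by exists c; split=> //; rewrite -e; exact: isrep_proj_pt.
exists (nz (isrep_neq0 vx)); first by exists c; split.
exact: isrep_inj (isrep_nz _) vx.
Qed.

End Representatives.

(** * Topology of projective space through homogeneous coordinates *)

Section ProjectiveTopology.
Context {R : realType} {n : nat}.
Local Notation P := (proj_space R n).
Implicit Types (Omega : set P) (x y : P) (v w : 'cV[R]_n.+1).

Definition lifts Omega : set 'cV[R]_n.+1 := [set v | exists2 x, Omega x & isrep v x].

Lemma liftsP Omega v x : isrep v x -> lifts Omega v <-> Omega x.
Proof.
by move=> vx; split=> [[y Oy /isrep_inj/(_ vx) <-]|Ox]; [|exists x].
Qed.

Lemma liftsZ Omega c v : c != 0 -> lifts Omega v -> lifts Omega (c *: v).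
Proof. by move=> c0 [x Ox vx]; exists x => //; exact: isrepZ. Qed.

Lemma nzvec_val_continuous :
  continuous (fun v : nzvec R n => set_val v : 'cV[R]_n.+1).
Proof. exact: initial_continuous. Qed.

Lemma neq0_open : open [set t : R | t != 0].
Proof.
rewrite (_ : mkset _ = ~` [set 0]); first by apply: closed_openC; exact: closed_eq.
by apply/seteqP; split=> t /= /eqP.
Qed.

Lemma mx_neq0_open : open [set v : 'cV[R]_n.+1 | v != 0].
Proof.
rewrite (_ : mkset _ = (fun v : 'cV[R]_n.+1 => `|v|) @^-1` [set t : R | t != 0]).
  by apply: open_comp; [move=> v _; exact: norm_continuous|exact: neq0_open].
by apply/seteqP; split=> v /=; rewrite normr_eq0.
Qed.

Lemma open_lifts Omega : open Omega -> open (lifts Omega).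
Proof.
move=> [W oW WE].
rewrite (_ : lifts _ = W `&` [set v : 'cV[R]_n.+1 | v != 0]).
  by apply: openI => //; exact: mx_neq0_open.
apply/seteqP; split=> v.
  move=> [x Ox vx]; have v0 := isrep_neq0 vx; split=> //.
  suff : (set_val @^-1` W) (nz v0) by [].
  rewrite WE; change (Omega (proj_pt (nz v0))).
  by rewrite (isrep_inj (isrep_nz v0) vx).
move=> [Wv v0]; exists (proj_pt (nz v0)); last exact: isrep_nz.
by have : (set_val @^-1` W) (nz v0) by []; rewrite WE.
Qed.

(** The projection is open: the saturation of an open set [V] of vectors is the union of its
    rescalings. Hence neighbourhoods upstairs and downstairs correspond. *)
Lemma closure_lifts Omega v x : isrep v x ->
  closure Omega x <-> closure (lifts Omega) v.
Proof.
move=> vx; split=> cl.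
  move=> U; rewrite nbhsE => -[V [oV Vv] VU].
  pose O := [set y | exists2 u, V u & isrep u y].
  have oO : open O.
    suff : open ((@proj_pt R n) @^-1` O) by [].
    rewrite (_ : _ @^-1` _ = \bigcup_(c in [set c : R | c != 0])
        ((fun u : nzvec R n => c *: (set_val u : 'cV[R]_n.+1)) @^-1` V)); last first.
      apply/seteqP; split=> u.
        move=> [w Vw wu]; have [c c0 e] := isrep_colinear (isrep_proj_pt u) wu.
        by exists c => //=; rewrite -e.
      move=> [c c0 Vu]; exists (c *: set_val u) => //.
      by apply: isrepZ => //; exact: isrep_proj_pt.
    apply: bigcup_open => c _.
    have oc : open ((fun w : 'cV[R]_n.+1 => c *: w) @^-1` V).
      by apply: open_comp => // w _; exact: scaler_continuous.
    by apply: open_comp oc => u _; exact: nzvec_val_continuous.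
  have [y [Oy [u Vu uy]]] : Omega `&` O !=set0.
    by apply: cl; apply: open_nbhs_nbhs; split=> //; exists v.
  exists u; split; first by exists y.
  exact/VU.
move=> O; rewrite nbhsE => -[V [oV Vx] VO].
have [w [[y Oy wy] [z Vz wz]]] : lifts Omega `&` lifts V !=set0.
  apply: cl; apply: open_nbhs_nbhs; split; first exact: open_lifts.
  by exists x.
by exists y; split=> //; apply: VO; rewrite (isrep_inj wy wz).
Qed.

(** The ratio has degree 0, so it descends to the quotient, and its continuity is checked on
    vectors. *)
Lemma chart_ratio_continuous (b f : 'rV[R]_n.+1) x : chart f x ->
  {for x, continuous (fun y : P => lform b (proj_vec y) / lform f (proj_vec y))}.
Proof.
move=> fx U; rewrite nbhsE => -[V [oV Vx] VU].
pose phi (v : 'cV[R]_n.+1) := lform b v / lform f v.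
have phiE v y : isrep v y -> phi v = phi (proj_vec y).
  case=> c c0 ->; rewrite /phi !lformZ.
  have [->|f0] := eqVneq (lform f (proj_vec y)) 0; first by rewrite mulr0 invr0 !mulr0.
  by field; rewrite c0 f0.
have fE v y : isrep v y -> (lform f v != 0) = (lform f (proj_vec y) != 0).
  by case=> c c0 ->; rewrite lformZ mulf_eq0 negb_or c0.
pose O := [set y : P | chart f y /\ V (phi (proj_vec y))].
have oW : open [set v | lform f v != 0 /\ V (phi v)].
  rewrite openE => v [fv Vv]; apply: filterS2.
  - by move=> u h1 h2; split; [exact: h1|exact: h2].
  - have : open_nbhs v ((fun u : 'cV[R]_n.+1 => lform f u) @^-1` [set t | t != 0]).
      split=> //; apply: open_comp => [u _|]; first exact: mulmx_entry_continuous.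
      exact: neq0_open.
    exact: open_nbhs_nbhs.
  - have cphi : {for v, continuous phi}.
      apply: (@continuousM _ _ (fun v => lform b v) (fun v => (lform f v)^-1)).
        exact: mulmx_entry_continuous.
      by apply: continuousV => //; exact: mulmx_entry_continuous.
    by apply: cphi; exact: open_nbhs_nbhs.
have oO : open O.
  suff : open ((@proj_pt R n) @^-1` O) by [].
  rewrite (_ : _ @^-1` _ = (@set_val _ _) @^-1`
      [set v : 'cV[R]_n.+1 | lform f v != 0 /\ V (phi v)]).
    by apply: open_comp => // u _; exact: nzvec_val_continuous.
  apply/seteqP; split=> u [h1 h2]; have ru := isrep_proj_pt u; split.
  - by rewrite (fE _ _ ru).
  - by rewrite (phiE _ _ ru).
  - by rewrite /chart /= -(fE _ _ ru).
  - by rewrite -(phiE _ _ ru).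
have : nbhs x O by apply: open_nbhs_nbhs; split.
by apply: filterS => y [_ /VU].
Qed.

End ProjectiveTopology.

(** * The cone over a properly convex domain and its Hilbert metric *)

Section Cone.
Context {R : realType} {n : nat}.
Implicit Types (Omega : set (proj_space R n)) (x y : proj_space R n)
  (v w : 'cV[R]_n.+1) (f : 'rV[R]_n.+1).

(** The lifts of a properly convex set form two opposite convex cones; the sign of the chart form
    selects one. *)
Definition cone f Omega : set 'cV[R]_n.+1 :=
  [set v | lifts Omega v /\ 0 < lform f v].

Lemma chart_ptE f v x : isrep v x -> chart_pt f x = (lform f v)^-1 *: v.
Proof.
case=> c c0 ->; rewrite /chart_pt lformZ scalerA.
by rewrite invfM mulrAC mulVf// mul1r.
Qed.

Lemma chartP f v x : isrep v x -> chart f x <-> lform f v != 0.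
Proof.
by case=> c c0 ->; rewrite lformZ mulf_eq0 negb_or c0.
Qed.

Lemma isrep_chart_pt f x : chart f x -> isrep (chart_pt f x) x.
Proof. by move=> fx; apply: isrepZ; rewrite ?invr_neq0//; exact: isrep_proj_vec. Qed.

Lemma coneZ f Omega c v : 0 < c -> cone f Omega v -> cone f Omega (c *: v).
Proof.
move=> c0 [Ov fv]; split; last by rewrite lformZ mulr_gt0.
by apply: liftsZ => //; rewrite gt_eqF.
Qed.

Lemma cone_open f Omega : open Omega -> open (cone f Omega).
Proof.
move=> oO; apply: openI; first exact: open_lifts.
apply: (@open_comp _ _ (lform f) [set t : R | 0 < t]); last exact: open_gt.
by move=> v _; exact: mulmx_entry_continuous.
Qed.

Lemma convex_lmodE (E : lmodType R) (t : {i01 R}) (a b : convex_lmodType E) :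
  conv t a b = t%:num *: (a : E) + (1 - t%:num) *: (b : E).
Proof. by []. Qed.

(** After division by lform f v + lform f w, the sum is a convex combination of the two chart
    points. *)
Lemma coneD f Omega v w : convex_set (chart_pt f @` Omega) ->
  cone f Omega v -> cone f Omega w -> cone f Omega (v + w).
Proof.
move=> cO [[x Ox vx] fv] [[y Oy wy] fw].
split; last by rewrite lformD addr_gt0.
have ab : 0 < lform f v + lform f w by rewrite addr_gt0.
have l0 : 0 <= lform f v / (lform f v + lform f w) by rewrite divr_ge0 ?ltW.
have l1 : lform f v / (lform f v + lform f w) <= 1.
  by rewrite ler_pdivrMr// mul1r lerDl ltW.
have := cO (chart_pt f x) (chart_pt f y) (Itv01 l0 l1) (mem_set (imageP _ Ox))
  (mem_set (imageP _ Oy)).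
rewrite inE => -[z Oz ze]; exists z => //.
(* Were this 0, the chart point of [z] would be 0, since the inverse of 0 is 0, whereas a convex
   combination of the two chart points has [f]-value 1. *)
have fz : lform f (proj_vec z) != 0.
  apply/eqP => fz; move: ze; rewrite (chart_ptE f vx) (chart_ptE f wy).
  rewrite (chart_ptE f (isrep_proj_vec z)) fz invr0 scale0r => /(congr1 (lform f)).
  rewrite lform0 convex_lmodE /= lformD !lformZ !mulVf ?gt_eqF// !mulr1.
  by rewrite addrC subrK => /eqP; rewrite eq_sym oner_eq0.
have -> : v + w = (lform f v + lform f w) *: chart_pt f z.
  rewrite ze (chart_ptE f vx) (chart_ptE f wy).
  rewrite convex_lmodE /= scalerDr !scalerA; congr (_ + _).
    by rewrite [X in X *: _](_ : _ = 1) ?scale1r//; field; rewrite !gt_eqF.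
  by rewrite [X in X *: _](_ : _ = 1) ?scale1r//; field; rewrite !gt_eqF.
exists ((lform f v + lform f w) * (lform f (proj_vec z))^-1).
  by rewrite mulf_neq0 ?invr_neq0// gt_eqF.
by rewrite scalerA.
Qed.

Lemma cone_bounded f Omega : Omega `<=` chart f ->
  bounded_set (chart_pt f @` Omega) -> exists M, forall v, lifts Omega v ->
    `|v| <= M * `|lform f v|.
Proof.
move=> Of [M [_ HM]]; exists (M + 1) => v [x Ox vx].
have fv : lform f v != 0 by exact/(chartP f vx)/Of.
have : `|chart_pt f x| <= M + 1 by apply: (HM (M + 1)); [rewrite ltrDl|exists x].
by rewrite (chart_ptE f vx) normrZ normfV mulrC ler_pdivrMr ?normr_gt0.
Qed.

(** Boundedness reads |v| <= M |f v| on lifts. This closed condition passes to the closure and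
    excludes nonzero vectors with f v = 0. *)
Lemma closure_sub_chart f Omega : Omega `<=` chart f ->
  bounded_set (chart_pt f @` Omega) -> closure Omega `<=` chart f.
Proof.
move=> Of bO x Ox; have [M HM] := cone_bounded Of bO.
apply/(chartP f (isrep_proj_vec x)).
have /(closure_lifts _ (isrep_proj_vec x)) cx := Ox.
apply/eqP => fx0.
have : closed [set v : 'cV[R]_n.+1 | `|v| - M * `|lform f v| <= 0].
  have cont : continuous (fun v : 'cV[R]_n.+1 => `|v| - M * `|lform f v|).
    move=> v; apply: (@cvgB _ _ _ (nbhs v)); first exact: norm_continuous.
    apply: (@cvgMl_tmp _ _ (nbhs v)); apply: (@cvg_norm _ _ _ (nbhs v)).
    exact: mulmx_entry_continuous.
  apply: (@preimage_closed _ _ _ [set t : R | t <= 0]); last exact: closed_le.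
  by move=> v _; exact: cont.
rewrite closure_id => cl.
have : [set v : 'cV[R]_n.+1 | `|v| - M * `|lform f v| <= 0] (proj_vec x).
  rewrite cl; apply: closure_subset cx => v /HM /=; lra.
rewrite /= fx0 normr0 mulr0 subr0 normr_le0 => /eqP h.
by have := proj_vec_neq0 x; rewrite h eqxx.
Qed.

Lemma cone_lifts f Omega v : Omega `<=` chart f -> lifts Omega v ->
  cone f Omega v \/ cone f Omega (- v).
Proof.
move=> Of [x Ox vx]; have : lform f v != 0 by exact/(chartP f vx)/Of.
rewrite neq_lt => /orP[fv|fv]; [right|left]; last by split=> //; exists x.
split; last by rewrite lformN oppr_gt0.
by exists x => //; rewrite -scaleN1r; apply: isrepZ; rewrite // oppr_eq0 oner_eq0.
Qed.

Lemma closure_cone f Omega v x : isrep v x -> 0 < lform f v ->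
  closure Omega x -> closure (cone f Omega) v.
Proof.
move=> vx fv /(closure_lifts _ vx) cl U Uv.
have Pv : nbhs v [set w | 0 < lform f w].
  apply: open_nbhs_nbhs; split=> //.
  apply: (@open_comp _ _ (lform f) [set t : R | 0 < t]); last exact: open_gt.
  by move=> w _; exact: mulmx_entry_continuous.
have [w [Ow [Uw fw]]] := cl _ (filterI Uv Pv).
by exists w.
Qed.

(* A change of sign would produce a zero on a segment contained in the cone. *)
Lemma cone_sign f Omega (g : 'rV[R]_n.+1) : convex_set (chart_pt f @` Omega) ->
  Omega `<=` chart g ->
  (forall v, cone f Omega v -> 0 < lform g v) \/
  (forall v, cone f Omega v -> lform g v < 0).
Proof.
move=> cO Og.
have g0 v : cone f Omega v -> lform g v != 0.
  by move=> [[x Ox vx] _]; exact/(chartP g vx)/Og.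
have [[v Kv gv]|no] := pselect (exists2 v, cone f Omega v & 0 < lform g v).
  left=> w Kw; rewrite ltNge; apply/negP => gw.
  have {}gw : lform g w < 0 by rewrite lt_neqAle gw g0.
  have : cone f Omega (- lform g w *: v + lform g v *: w).
    by apply: coneD => //; apply: coneZ => //; rewrite oppr_gt0.
  by move=> /g0; rewrite lformD !lformZ mulNr mulrC addNr eqxx.
right=> v Kv; rewrite lt_neqAle g0//= leNgt; apply/negP => gv.
by apply: no; exists v.
Qed.

(* When [Omega] is nonempty, open and properly convex, this is the closure of
   [cone f Omega]. *)
Definition closed_cone f Omega : set 'cV[R]_n.+1 :=
  [set w | forall z, cone f Omega z -> cone f Omega (z + w)].

(** For [u] in the cone and close to [w], the vector z + w - u is close to [z], hence in the open
    cone, and z + w is the sum of these two elements. *)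
Lemma closure_cone_sub f Omega : open Omega ->
  convex_set (chart_pt f @` Omega) ->
  closure (cone f Omega) `<=` closed_cone f Omega.
Proof.
move=> oO cO w cw z Kz.
have : nbhs w ((fun u => z + w - u) @^-1` cone f Omega).
  apply: open_nbhs_nbhs; split; last by rewrite /= addrK.
  apply: open_comp; last exact: cone_open.
  by move=> u _; apply: (@cvgB _ _ _ (nbhs u)); [exact: cvg_cst|exact: cvg_id].
move=> /cw[u [Ku Kzu]]; rewrite -(subrK u (z + w)); exact: coneD.
Qed.

End Cone.

Section HilbertMetric.
Context {R : realType} {n : nat}.
Context (Omega : set (proj_space R n)) (oO : open Omega) (f : 'rV[R]_n.+1).
Context (Of : Omega `<=` chart f) (bO : bounded_set (chart_pt f @` Omega)).
Context (cO : convex_set (chart_pt f @` Omega)).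
Local Notation K := (cone f Omega).
Local Notation Kc := (closed_cone f Omega).

Lemma closed_coneZ c w : 0 < c -> Kc w -> Kc (c *: w).
Proof.
move=> c0 Kw z Kz; have -> : z + c *: w = c *: (c^-1 *: z + w).
  by rewrite scalerDr scalerA mulfV ?scale1r// gt_eqF.
by apply: coneZ => //; apply: Kw; apply: coneZ => //; rewrite invr_gt0.
Qed.

Lemma closed_coneD v w : Kc v -> Kc w -> Kc (v + w).
Proof. by move=> Kv Kw z Kz; rewrite addrA; apply: Kw; exact: Kv. Qed.

Lemma cone_closed_cone v : K v -> Kc v.
Proof. by move=> Kv z Kz; exact: coneD. Qed.

Lemma closed_cone0 : Kc 0.
Proof. by move=> z; rewrite addr0. Qed.

Lemma cone_chart_pt x : Omega x -> K (chart_pt f x).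
Proof.
move=> Ox; have fx : lform f (proj_vec x) != 0.
  exact/(chartP f (isrep_proj_vec x))/Of.
split; last by rewrite lformZ mulVf// ltr01.
by exists x => //; apply: isrepZ; rewrite ?invr_neq0//; exact: isrep_proj_vec.
Qed.

(** The exit parameter is the supremum of those for which the line is in the cone: finite by
    boundedness, excluded by openness. It gives an endpoint of the chord. *)
Lemma cone_exit v w : K v -> K w -> v != w -> lform f v = 1 -> lform f w = 1 ->
  exists b : R, [/\ 1 < b, closure K (v + b *: (w - v)),
    ~ K (v + b *: (w - v)) & lform f (v + b *: (w - v)) = 1].
Proof.
move=> Kv Kw vw fv fw; pose l (t : R) := v + t *: (w - v).
have fl t : lform f (l t) = 1 by rewrite lformD lformZ lformB fv fw subrr mulr0 addr0.
have cl : continuous l.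
  by move=> t; apply: cvgD; [exact: cvg_cst|apply: cvgZr_tmp; exact: cvg_id].
pose T := [set t | K (l t)].
have T1 : T 1 by rewrite /T /= /l scale1r addrC subrK.
have oT : open T.
  by apply: open_comp; [move=> t _; exact: cl|exact: cone_open].
have [M HM] := cone_bounded Of bO.
have wv0 : 0 < `|w - v| by rewrite normr_gt0 subr_eq0 eq_sym.
have sT : has_sup T.
  split; first by exists 1.
  exists ((M + `|v|) / `|w - v|) => t [Lt _].
  have := HM _ Lt; rewrite fl normr1 mulr1 => lM.
  rewrite ler_pdivlMr//; apply: (@le_trans _ _ `|t *: (w - v)|).
    by rewrite normrZ ler_wpM2r// ler_norm.
  have -> : t *: (w - v) = l t - v by rewrite /l addrAC subrr add0r.
  by apply: le_trans (ler_normB _ _) _; rewrite lerD2r.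
have sup_notin : ~ T (sup T).
  move=> TT; have := open_nbhs_nbhs (conj oT TT).
  rewrite -nbhs_ballE => -[e /= e0 eT].
  have : T (sup T + e / 2).
    apply: eT; rewrite -ball_normE /= opprD addNKr normrN gtr0_norm ?divr_gt0//.
    by rewrite ltr_pdivrMr// mulr_natr mulr2n ltrDl.
  move=> /(ub_le_sup sT.2); rewrite leNgt => /negP; apply.
  by rewrite ltrDl divr_gt0.
have sup1 : 1 < sup T.
  rewrite lt_neqAle (ub_le_sup sT.2 T1) andbT; apply/eqP => e1.
  by apply: sup_notin; rewrite -e1.
exists (sup T); split=> //; last exact: fl.
move=> U Ul; have := cl (sup T) U Ul; rewrite -nbhs_ballE => -[e /= e0 eU].
have [t Tt st] := sup_adherent e0 sT.
exists (l t); split=> //; apply: eU; rewrite -ball_normE /=.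
have := ub_le_sup sT.2 Tt; rewrite ltr_norml; lra.
Qed.

(** This ensures that [hilbert_dist] does not fall back on the default 0 of [xget]. *)
Lemma hilbert_value_exists x y : Omega x -> Omega y -> x != y ->
  exists r, hilbert_value Omega x y r.
Proof.
move=> Ox Oy xy; have Kx := cone_chart_pt Ox; have Ky := cone_chart_pt Oy.
set v := chart_pt f x in Kx; set w := chart_pt f y in Ky.
have rep z : Omega z -> isrep (chart_pt f z) z /\ lform f (chart_pt f z) = 1.
  move=> Oz; have fz : lform f (proj_vec z) != 0.
    exact/(chartP f (isrep_proj_vec z))/Of.
  split; last by rewrite lformZ mulVf.
  by apply: isrepZ; rewrite ?invr_neq0//; exact: isrep_proj_vec.
have [vx fv] := rep x Ox; have [wy fw] := rep y Oy; rewrite -/v -/w in vx fv wy fw.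
have vw : v != w.
  by apply: contra_neq xy => vw; apply: isrep_inj vx _; rewrite vw.
have [b [b1 clb Kb fb]] := cone_exit Kx Ky vw fv fw.
have wv : w != v by rewrite eq_sym.
have [a [a1 cla Ka fa]] := cone_exit Ky Kx wv fw fv.
have bd u : closure K u -> ~ K u -> lform f u = 1 ->
    exists2 z, boundary Omega z & chart_pt f z = u.
  move=> clu Ku fu; have u0 : u != 0.
    by apply: contra_eq_neq fu => ->; rewrite lform0 eq_sym oner_neq0.
  have [z uz] := isrep_exists u0; exists z; last first.
    by rewrite (chart_ptE f uz) fu invr1 scale1r.
  split.
    by apply/(closure_lifts _ uz); apply: closure_subset clu => ? [].
  move=> Oi; have Oz : Omega z by exact: interior_subset Oi.
  apply: Ku; split; first by exists z.
  by rewrite fu ltr01.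
have [x' bx' ex'] := bd _ cla Ka fa; have [y' by' ey'] := bd _ clb Kb fb.
(* In the parameter with [v] at 0 and [w] at 1, the chord runs from 1 - a to b; rescaling it to
   [0, 1] puts [v] at (a - 1)/d and [w] at a/d. *)
pose d := b + a - 1.
have d0 : d != 0 by rewrite gt_eqF// /d; lra.
eexists; exists f, x', y', ((a - 1) / d), (a / d).
have dd : 0 < d by rewrite /d; lra.
have f0 : f != 0.
  apply: contra_eq_neq fv => ->; rewrite /lform mul0mx mxE eq_sym; exact: oner_neq0.
split; last by reflexivity.
- by split=> //; exact: closure_sub_chart.
- split; first by rewrite divr_ge0 ?ltW// subr_gt0.
    by rewrite ler_pM2r ?invr_gt0// lerBlDr lerDl.
  by rewrite ler_pdivrMr// mul1r /d; lra.
- rewrite ex' ey' -/v; move: v w {Kx Ky vx fv wy fw vw clb Kb fb wv cla Ka fa ex' ey'}.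
  by move=> v w; apply/colP => i; rewrite !mxE /d; field.
- rewrite ex' ey' -/w; move: v w {Kx Ky vx fv wy fw vw clb Kb fb wv cla Ka fa ex' ey'}.
  by move=> v w; apply/colP => i; rewrite !mxE /d; field.
Qed.

End HilbertMetric.

(** * The Hilbert distance and the order of the cone *)

Section HilbertOrder.
Context {R : realType} {n : nat}.
Context (Omega : set (proj_space R n)) (oO : open Omega) (f : 'rV[R]_n.+1).
Context (Of : Omega `<=` chart f) (bO : bounded_set (chart_pt f @` Omega)).
Context (cO : convex_set (chart_pt f @` Omega)).
Local Notation K := (cone f Omega).
Local Notation Kc := (closed_cone f Omega).

(** This frees a candidate value from its chart [g] and from the norm: the endpoints get lifts [X],
    [Y] in the closed cone but not in the open one, and the cross-ratio is read off the parameters.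
    All estimates then hold for any candidate, in particular the one picked by [xget]. *)
Lemma hilbert_value_cone x y v w r : isrep v x -> isrep w y -> K v -> K w ->
  x != y -> hilbert_value Omega x y r ->
  exists X Y : 'cV[R]_n.+1, exists s u a b : R,
    [/\ [/\ Kc X, Kc Y, ~ K X & ~ K Y], [/\ 0 < s, s < u, u < 1, 0 < a & 0 < b],
        a *: v = X + s *: (Y - X), b *: w = X + u *: (Y - X) &
        r = 2^-1 * ln ((u * (1 - s)) / (s * (1 - u)))].
Proof.
move=> vx wy Kv Kw xy [g [x' [y' [s [u []]]]]].
move=> [g0 clg [clx' bx'] [cly' by']] [s0 su u1] ex ey er.
have Og : Omega `<=` chart g by move=> z Oz; apply: clg; exact: subset_closure.
have [Ox Oy] : Omega x /\ Omega y.
  by split; [have [/(liftsP _ vx)] := Kv|have [/(liftsP _ wy)] := Kw].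
have noO z : ~ Omega° z -> ~ Omega z by move=> h Oz; apply: h; exact: open_nbhs_nbhs.
have {bx'} bx' := noO _ bx'; have {by'} by' := noO _ by'.
(* Up to a global sign, the chart form of the value is positive on the cone. *)
have [e e0 eg] : exists2 e : R, e != 0 & forall z, K z -> 0 < e * lform g z.
  have [gp|gn] := cone_sign cO Og.
    by exists 1; [exact: oner_neq0|move=> z /gp; rewrite mul1r].
  by exists (-1); [rewrite oppr_eq0 oner_neq0|move=> z /gn; rewrite mulN1r oppr_gt0].
pose h := e *: g.
have hK z : K z -> 0 < lform h z by move=> /eg; rewrite lformZl.
have gz z : closure Omega z -> lform g (proj_vec z) != 0.
  by move=> /clg /(chartP g (isrep_proj_vec z)).
have rep z : closure Omega z ->
    isrep (e^-1 *: chart_pt g z) z /\ lform h (e^-1 *: chart_pt g z) = 1.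
  move=> cz; have gzz := gz z cz; split.
    apply: isrepZ; first by rewrite invr_neq0.
    by apply: isrepZ; rewrite ?invr_neq0//; exact: isrep_proj_vec.
  by rewrite lformZl lformZ lformZ mulrA mulfV// mul1r mulVf.
have hcone z : cone h Omega z -> K z.
  move=> [Oz hz]; have [//|Knz] := cone_lifts Of Oz.
  by have := hK _ Knz; rewrite lformN oppr_gt0 ltNge ltW.
have bd z : closure Omega z -> ~ Omega z ->
    Kc (e^-1 *: chart_pt g z) /\ ~ K (e^-1 *: chart_pt g z).
  move=> cz noz; have [rz hz] := rep z cz; split; last by move=> [/(liftsP _ rz)].
  apply: closure_cone_sub => //; apply: (@closure_subset _ (cone h Omega)) => //.
  by apply: closure_cone rz _ cz; rewrite hz ltr01.
have scal z v' : isrep v' z -> K v' -> exists2 a : R, 0 < a &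
    a *: v' = e^-1 *: chart_pt g z.
  move=> vz Kv'; have Oz : Omega z by have [/(liftsP _ vz)] := Kv'.
  have [rz hz] := rep z (subset_closure Oz).
  have [a a0 az] := isrep_colinear vz rz; exists a => //.
  have := hK _ Kv'; move: hz; rewrite az lformZ => ah hv.
  by rewrite -(pmulr_lgt0 _ hv) ah ltr01.
have [a a0 av] := scal x v vx Kv; have [b b0 bw] := scal y w wy Kw.
have [Xc XK] := bd x' clx' bx'; have [Yc YK] := bd y' cly' by'.
set X := e^-1 *: chart_pt g x' in Xc XK; set Y := e^-1 *: chart_pt g y' in Yc YK.
have aX : a *: v = X + s *: (Y - X).
  rewrite av ex /X /Y; move: (chart_pt g x') (chart_pt g y') => p q.
  by apply/colP => i; rewrite !mxE; ring.
have bX : b *: w = X + u *: (Y - X).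
  rewrite bw ey /X /Y; move: (chart_pt g x') (chart_pt g y') => p q.
  by apply/colP => i; rewrite !mxE; ring.
have xyne : chart_pt g x <> chart_pt g y.
  move=> exy; move/eqP: xy; apply.
  have [rx _] := rep x (subset_closure Ox); have [ry _] := rep y (subset_closure Oy).
  by apply: isrep_inj rx _; rewrite exy.
have Kav : K (a *: v) by exact: coneZ.
have Kbw : K (b *: w) by exact: coneZ.
have s_gt0 : 0 < s.
  rewrite lt_neqAle s0 andbT; apply/eqP => es.
  by apply: XK; move: Kav; rewrite aX -es scale0r addr0.
have u_lt1 : u < 1.
  rewrite lt_neqAle u1 andbT; apply/eqP => eu.
  by apply: YK; move: Kbw; rewrite bX eu scale1r addrC subrK.
have s_lt_u : s < u.
  by rewrite lt_neqAle su andbT; apply/eqP => e1; apply: xyne; rewrite ex ey e1.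
exists X, Y, s, u, a, b; split=> //.
rewrite er; congr (_ * ln _); set p := chart_pt g x' in ex ey *.
set q := chart_pt g y' in ex ey *.
have pq : 0 < `|q - p|.
  rewrite normr_gt0; apply/eqP => qp0; apply: xyne.
  by rewrite ex ey qp0 !scaler0.
have -> : `|p - chart_pt g y| = u * `|q - p|.
  by rewrite ey opprD addNKr normrN normrZ ger0_norm// ltW// (lt_trans s_gt0).
have -> : `|p - chart_pt g x| = s * `|q - p|.
  by rewrite ex opprD addNKr normrN normrZ ger0_norm.
have -> : `|q - chart_pt g x| = (1 - s) * `|q - p|.
  have -> : q - chart_pt g x = (1 - s) *: (q - p).
    by rewrite ex scalerBl scale1r opprD addrA.
  by rewrite normrZ ger0_norm// subr_ge0 ltW// (lt_trans s_lt_u).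
have -> : `|q - chart_pt g y| = (1 - u) * `|q - p|.
  have -> : q - chart_pt g y = (1 - u) *: (q - p).
    by rewrite ey scalerBl scale1r opprD addrA.
  by rewrite normrZ ger0_norm// subr_ge0.
by field; rewrite !gt_eqF// subr_gt0.
Qed.

Local Notation d := (hilbert_dist Omega).

Lemma hilbert_distP x y : Omega x -> Omega y -> x != y ->
  hilbert_value Omega x y (d x y).
Proof.
move=> Ox Oy xy; have [r hr] := hilbert_value_exists oO Of bO Ox Oy xy.
rewrite /hilbert_dist (negPf xy); exact: xgetI hr.
Qed.

Lemma hilbert_dist_ge0 x y : Omega x -> Omega y -> 0 <= d x y.
Proof.
move=> Ox Oy; have [->|xy] := eqVneq x y; first by rewrite /hilbert_dist eqxx.
have [X [Y [s [u [a [b [_ [s0 su u1 _ _] _ _ ->]]]]]]] :=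
  hilbert_value_cone (isrep_chart_pt (Of Ox)) (isrep_chart_pt (Of Oy))
    (cone_chart_pt Of Ox) (cone_chart_pt Of Oy) xy (hilbert_distP Ox Oy xy).
have u0 := lt_trans s0 su.
rewrite mulr_ge0 ?invr_ge0// ln_ge0// ler_pdivlMr ?mulr_gt0 ?subr_gt0//.
by rewrite mul1r !mulrBr !mulr1 (mulrC u s) lerD2r ltW.
Qed.

(* The cone order [v <= w] is [Kc (w - v)]. *)
Lemma hilbert_dist_order x y v w : isrep v x -> isrep w y -> K v -> K w ->
  x != y -> exists2 c : R, 0 < c &
    Kc (c *: v - w) /\ Kc (expR (2 * d x y) *: w - c *: v).
Proof.
move=> vx wy Kv Kw xy.
have [Ox Oy] : Omega x /\ Omega y.
  by split; [have [/(liftsP _ vx)] := Kv|have [/(liftsP _ wy)] := Kw].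
have [X [Y [s [u [a [b [[KX KY _ _] [s0 su u1 a0 b0] av bw ->]]]]]]] :=
  hilbert_value_cone vx wy Kv Kw xy (hilbert_distP Ox Oy xy).
have u0 : 0 < u by exact: lt_trans su.
have s1 : s < 1 by exact: lt_trans u1.
rewrite mulrA mulfV ?mul1r ?pnatr_eq0// lnK; last first.
  by rewrite posrE divr_gt0// mulr_gt0// subr_gt0.
have -> : v = a^-1 *: (X + s *: (Y - X)) by rewrite -av scalerA mulVf ?scale1r// gt_eqF.
have -> : w = b^-1 *: (X + u *: (Y - X)) by rewrite -bw scalerA mulVf ?scale1r// gt_eqF.
exists (a * u / (b * s)); first by rewrite divr_gt0// mulr_gt0.
split.
  rewrite (_ : _ - _ = ((u - s) / (b * s)) *: X).
    by apply: closed_coneZ => //; rewrite divr_gt0 ?mulr_gt0// subr_gt0.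
  by apply/colP => i; rewrite !mxE; field; rewrite !gt_eqF.
rewrite (_ : _ - _ = ((u - s) * u / (b * s * (1 - u))) *: Y).
  by apply: closed_coneZ => //; rewrite divr_gt0 ?mulr_gt0// subr_gt0.
by apply/colP => i; rewrite !mxE; field; rewrite !gt_eqF// subr_gt0.
Qed.

(** Conversely, too small an [r] would make a positive multiple of an endpoint [X] or [Y] the sum of
    an element of the open cone and one of the closed cone, placing that endpoint in the open
    cone. *)
Lemma hilbert_dist_le x y v w c r : isrep v x -> isrep w y -> K v -> K w ->
  0 < c -> 0 < r -> Kc (c *: w - v) -> Kc (r *: v - c *: w) ->
  d x y <= 2^-1 * ln r.
Proof.
move=> vx wy Kv Kw c0 r0 K1 K2.
have [Ox Oy] : Omega x /\ Omega y.
  by split; [have [/(liftsP _ vx)] := Kv|have [/(liftsP _ wy)] := Kw].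
have [exy|xy] := eqVneq x y.
  rewrite /hilbert_dist exy eqxx mulr_ge0 ?invr_ge0// ln_ge0// leNgt.
  (* The three terms add up to 0, so r < 1 would put 0 in the open cone. *)
  apply/negP => r1; have : K ((1 - r) *: v + (c *: w - v) + (r *: v - c *: w)).
    by apply: K2; apply: K1; apply: coneZ; rewrite ?subr_gt0.
  rewrite (_ : _ + _ = 0) => [[_]|]; first by rewrite lform0 ltxx.
  by apply/colP => i; rewrite !mxE; ring.
have [X [Y [s [u [a [b [[_ _ nX nY] [s0 su u1 a0 b0] av bw ->]]]]]]] :=
  hilbert_value_cone vx wy Kv Kw xy (hilbert_distP Ox Oy xy).
have u0 : 0 < u by exact: lt_trans su.
have s1 : s < 1 by exact: lt_trans u1.
have us : 0 < u - s by rewrite subr_gt0.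
have vE : v = a^-1 *: (X + s *: (Y - X)) by rewrite -av scalerA mulVf ?scale1r// gt_eqF.
have wE : w = b^-1 *: (X + u *: (Y - X)) by rewrite -bw scalerA mulVf ?scale1r// gt_eqF.
rewrite ler_pM2l ?invr_gt0// ler_ln ?posrE//; last first.
  by rewrite divr_gt0// mulr_gt0// subr_gt0.
(* The weights in the contradiction are those for which [X] cancels; in [le2] they make [Y] cancel.
   The product of the two inequalities bounds the cross-ratio by [r]. *)
have le1 : (1 - s) * b <= c * a * (1 - u).
  rewrite leNgt; apply/negP => lt1; apply: nY.
  have : K (((1 - s) * b - c * a * (1 - u)) *: w + (a * (1 - u)) *: (c *: w - v)).
    have /(closed_coneZ _) K1' := K1; apply: K1'; first by rewrite mulr_gt0// subr_gt0.
    by apply: coneZ => //; rewrite subr_gt0.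
  have -> : ((1 - s) * b - c * a * (1 - u)) *: w + (a * (1 - u)) *: (c *: w - v) =
      (u - s) *: Y.
    rewrite vE wE; apply/colP => i; rewrite !mxE; field; rewrite !gt_eqF//.
  move=> /(coneZ (c := (u - s)^-1)); rewrite scalerA mulVf ?gt_eqF// scale1r.
  by rewrite invr_gt0; apply.
have le2 : u * a * c <= s * r * b.
  rewrite leNgt; apply/negP => lt2; apply: nX.
  have : K ((u * a - s * r * b / c) *: v + (s * b / c) *: (r *: v - c *: w)).
    have /(closed_coneZ _) K2' := K2; apply: K2'; first by rewrite divr_gt0// mulr_gt0.
    by apply: coneZ => //; rewrite subr_gt0 ltr_pdivrMr.
  have -> : (u * a - s * r * b / c) *: v + (s * b / c) *: (r *: v - c *: w) =
      (u - s) *: X.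
    rewrite vE wE; apply/colP => i; rewrite !mxE; field; rewrite !gt_eqF//.
  move=> /(coneZ (c := (u - s)^-1)); rewrite scalerA mulVf ?gt_eqF// scale1r.
  by rewrite invr_gt0; apply.
rewrite ler_pdivrMr ?mulr_gt0 ?subr_gt0//.
rewrite -(ler_pM2r (mulr_gt0 (mulr_gt0 a0 c0) b0)).
have -> : u * (1 - s) * (a * c * b) = (u * a * c) * ((1 - s) * b) by ring.
have -> : r * (s * (1 - u)) * (a * c * b) = (s * r * b) * (c * a * (1 - u)) by ring.
by apply: ler_pM => //; rewrite !mulr_ge0 ?subr_ge0// ltW.
Qed.

End HilbertOrder.

(** * Lifting the reflections *)

Section VertexSign.
Context {R : realType} {n : nat} {J : coxeter_diagram n}.
Context (hypJ : hyperbolic R J) (G : hyp_realization R J).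
Context (q : 'I_n.+1 -> hyp R n).
Context (qE : forall i j, j != i -> lorentz (hyp_vec (q i)) (hr_normal G j) = 0).

(* The (i, j) entry of the inverse Cartan matrix is nonpositive, and it is
   [lorentz (q i) (q j) < 0] divided by the product below. *)
Lemma vertex_sign i j : i != j ->
  0 < lorentz (hyp_vec (q i)) (hr_normal G i) * lorentz (hyp_vec (q j)) (hr_normal G j).
Proof.
move=> ij; pose s k := lorentz (hyp_vec (q k)) (hr_normal G k).
rewrite -/(s i) -/(s j).
pose w := invmx (normals G) *m hyp_vec (q i).
have Nw : normals G *m w = hyp_vec (q i) by rewrite mulKVmx// normals_unit.
have Cw m : (cartan R J *m w) m 0 = if m == i then s i else 0.
  rewrite -(lorentz_normal G) Nw; case: eqVneq => [->//|mi]; exact: qE.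
have wi : w i 0 * s i = -1.
  rewrite -(hyp_lorentz (q i)) -Nw lorentz_normals bform_sumE (bigD1 i) //=.
  by rewrite big1 ?addr0 ?Cw ?eqxx// => k ki; rewrite Cw (negPf ki) mulr0.
have wj : s j * w j 0 < 0.
  have := lorentz_timelike (hyp_timelike (q j)) (hyp_timelike (q i)).
  rewrite -{1}Nw (lorentz_normalsr G) (bigD1 j) //= big1 ?addr0// => k kj.
  by rewrite qE ?mul0r.
(* This is -s_i w with the i-th entry erased. Since s_i w_i = -1, the Cartan matrix sends it to the
   entries -C_mi >= 0 for m != i, so [posdef_on_ge0] applies. *)
pose c : 'cV[R]_n.+1 := \col_m (if m == i then 0 else - (s i * w m 0)).
have cF : supported (~: [set i]) c.
  by move=> m; rewrite !inE negbK mxE => ->.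
have Fp : ~: [set i] \proper [set: 'I_n.+1]%SET.
  by rewrite properT; apply/negP => /eqP/setP/(_ i); rewrite !inE eqxx.
have cj : 0 <= c j 0.
  apply: (posdef_on_ge0 (cartan_posdef_on hypJ Fp) _ cF) => [k l _ _|m].
    exact: cartan_offdiag_le0.
  rewrite !inE => mi.
  have -> : c = - (s i *: w) + (s i * w i 0) *: delta_mx i 0.
    apply/colP => k; rewrite mxE [RHS]mxE [X in _ = X + _]mxE [in RHS]mxE.
    rewrite [X in _ + X]mxE [X in _ + _ * X]mxE eqxx andbT.
    by case: eqVneq => [->|_]; [rewrite mulr1 addNr|rewrite mulr0 addr0].
  rewrite mulmxDr mulmxN -!scalemxAr -colE mxE [X in X + _]mxE [X in - X + _]mxE.
  rewrite Cw (negPf mi) mulr0 oppr0 add0r mxE [X in _ * X]mxE mulrC mulr_le0//.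
    exact: cartan_offdiag_le0.
  by rewrite mulrC wi lerN10.
move: cj; rewrite mxE eq_sym (negPf ij) oppr_ge0 => sw.
have sw0 : s i * w j 0 < 0.
  rewrite lt_neqAle sw andbT mulf_neq0//.
    by apply: contra_eq_neq wi => ->; rewrite mulr0 eq_sym oppr_eq0 oner_neq0.
  by apply: contraTneq wj => ->; rewrite mulr0 ltxx.
have : 0 < (s i * s j) * (w j 0 * w j 0).
  have -> : (s i * s j) * (w j 0 * w j 0) = (s i * w j 0) * (s j * w j 0) by ring.
  by rewrite nmulr_rgt0.
rewrite -expr2 pmulr_lgt0// exprn_even_gt0//=.
by apply: contraTneq wj => ->; rewrite mulr0 ltxx.
Qed.

End VertexSign.

(** * Linear lifts of the projective reflections *)

Section ReflectionLift.
Context {R : realType} {n : nat}.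
Context (B : GL R n).

Definition vertex (j : 'I_n.+1) : 'cV[R]_n.+1 := val B *m delta_mx j 0.
(** The basis dual to the vertices; the kernel of the i-th form is the linear span of the i-th
    face. *)
Definition bary (i : 'I_n.+1) : 'rV[R]_n.+1 := row i (invmx (val B)).

Lemma lform_bary i v : lform (bary i) v = (invmx (val B) *m v) i 0.
Proof. by rewrite /lform /bary -row_mul mxE. Qed.

Lemma lform_bary_mul i c : lform (bary i) (val B *m c) = c i 0.
Proof. by rewrite lform_bary mulKmx// (valP B). Qed.

Lemma bary_vertex i j : lform (bary i) (vertex j) = (i == j)%:R.
Proof. by rewrite lform_bary_mul mxE eqxx andbT. Qed.

Definition refl_mx (a : 'cV[R]_n.+1) (i : 'I_n.+1) : 'M[R]_n.+1 := 1%:M - a *m bary i.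

Lemma refl_mxE a i v : refl_mx a i *m v = v - lform (bary i) v *: a.
Proof.
rewrite mulmxBl mul1mx -mulmxA [bary i *m v]mx11_scalar -mul_mx_scalar; congr (_ - _).
Qed.

Lemma mul_vertex_ext (M M' : 'M[R]_n.+1) :
  (forall j, M *m vertex j = M' *m vertex j) -> M = M'.
Proof.
move=> MM'; rewrite -[M](mulmxK (valP B)) -[M'](mulmxK (valP B)); congr (_ *m _).
apply/matrixP => k j; have /colP/(_ k) := MM' j.
by rewrite !mulmxA -!colE !mxE.
Qed.

Lemma face_point i (c : 'cV[R]_n.+1) : (forall j, 0 <= c j 0) -> c i 0 = 0 -> c != 0 ->
  exists2 x, face B i x & isrep (val B *m c) x.
Proof.
move=> c0 ci cn0; have Bc0 : val B *m c != 0.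
  by apply: contra_neq cn0 => Bc; rewrite -(mulKmx (valP B) c) Bc mulmx0.
have [x vx] := isrep_exists Bc0; exists x => //.
apply/cellP; exists c; split=> //.
by move=> j; rewrite !inE negbK => /eqP ->.
Qed.

(** Fixing the face pointwise makes the representative a scalar on its span; normalizing this scalar
    to 1 leaves a rank-one perturbation of the identity, and being an involution fixes beta(a) =
    2. *)
Lemma reflection_lift (i : 'I_n.+1) (g : PGL R n) : (1 < n)%N ->
  (g * g)%g = 1%g -> g != 1%g -> (forall x, face B i x -> pgl_act g x = x) ->
  exists a, [/\ reps (refl_mx a i) g, a != 0 & lform (bary i) a = 2].
Proof.
move=> n2 gg g1 fix_g; set M := val (repr g).
have eig (c : 'cV[R]_n.+1) : (forall j, 0 <= c j 0) -> c i 0 = 0 -> c != 0 ->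
    exists2 l : R, l != 0 & M *m (val B *m c) = l *: (val B *m c).
  move=> c0 ci cn0; have [x fx vx] := face_point c0 ci cn0.
  apply: (isrep_colinear vx); rewrite -(fix_g x fx).
  exact: isrep_act (reps_repr g) vx.
have dge0 (j k : 'I_n.+1) : 0 <= (delta_mx j 0 : 'cV[R]_n.+1) k 0.
  by rewrite mxE ler0n.
have dn0 (j : 'I_n.+1) : (delta_mx j 0 : 'cV[R]_n.+1) != 0.
  apply/eqP => /colP/(_ j); rewrite !mxE !eqxx => /eqP; by rewrite oner_eq0.
have [k ki] : exists k : 'I_n.+1, k != i.
  by exists (lift i (Ordinal (ltnW n2))); rewrite eq_sym neq_lift.
have di (j : 'I_n.+1) : j != i -> (delta_mx j 0 : 'cV[R]_n.+1) i 0 = 0.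
  by move=> ji; rewrite mxE eq_sym (negPf ji).
have [l l0 Ml] := eig _ (dge0 k) (di _ ki) (dn0 k).
have Mv j : j != i -> M *m vertex j = l *: vertex j.
  move=> ji; have [->//|jk] := eqVneq j k.
  have [m m0 Mm] := eig _ (dge0 j) (di _ ji) (dn0 j).
  (* The sum of two vertices also represents a point of the face; being an eigenvector, it forces
     the two eigenvalues to agree. *)
  have [r r0 Mr] : exists2 r : R, r != 0 &
      M *m (val B *m (delta_mx j 0 + delta_mx k 0 : 'cV[R]_n.+1)) =
      r *: (val B *m (delta_mx j 0 + delta_mx k 0 : 'cV[R]_n.+1)).
    apply: eig => [p||].
    - by rewrite mxE addr_ge0.
    - by rewrite mxE !di// addr0.
    - apply/eqP => /colP/(_ j); rewrite !mxE !eqxx (negPf jk) addr0 => /eqP.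
      by rewrite oner_eq0.
  move: Mr; rewrite !mulmxDr Ml Mm -!/(vertex _) scalerDr => Mr.
  have := congr1 (lform (bary k)) Mr; have := congr1 (lform (bary j)) Mr.
  rewrite !lformD !lformZ !bary_vertex !eqxx (eq_sym k j) (negPf jk) !mulr1 !mulr0.
  by rewrite !addr0 !add0r => mr lr; rewrite mr lr.
pose T := l^-1 *: M.
have Tg : reps T g by apply: repsZ; rewrite ?invr_neq0//; exact: reps_repr.
have Tv j : j != i -> T *m vertex j = vertex j.
  by move=> ji; rewrite -scalemxAl Mv// scalerA mulVf// scale1r.
pose a := vertex i - T *m vertex i.
have TE : T = refl_mx a i.
  apply: mul_vertex_ext => j; rewrite refl_mxE bary_vertex.
  have [<-|ij] := eqVneq i j; first by rewrite scale1r /a subKr.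
  by rewrite scale0r subr0 Tv// eq_sym.
(* The square represents the identity, so it is a scalar, and its value at the fixed vertex [k]
   shows that this scalar is 1. *)
have TT : T *m T = 1%:M.
  have [c c0 cTT] :=
    reps_proportional (repsM Tg Tg) (eq_ind_r (reps 1%:M) (@reps1 R n) gg).
  have : vertex k = c *: vertex k.
    by rewrite -{1}[vertex k]mul1mx cTT -scalemxAl -mulmxA !Tv.
  move=> /(congr1 (lform (bary k))); rewrite lformZ bary_vertex eqxx mulr1 => c1.
  by rewrite cTT -c1 scale1r.
have a0 : a != 0.
  apply: contra_neq g1 => a0; have T1 : T = 1%:M.
    by rewrite TE a0 /refl_mx mul0mx subr0.
  have [c c0 e] := Tg; have [d d0 e'] := @reps1 R n.
  rewrite -(pgl_reprK g) -(pgl_reprK 1%g); apply/pglP.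
  exists (c^-1 * d); first by rewrite mulf_neq0 ?invr_neq0.
  by rewrite -scalerA -e' -T1 e scalerA mulVf// scale1r.
exists a; split=> //; first by rewrite -TE.
have : T *m (T *m vertex i) = vertex i by rewrite mulmxA TT mul1mx.
rewrite TE !refl_mxE bary_vertex eqxx scale1r lformB bary_vertex eqxx => e.
have alg (p r : 'cV[R]_n.+1) (t : R) : (t - 2) *: p = (r - p - (1 - t) *: p) - r.
  by apply/colP => m; rewrite !mxE; ring.
have : (lform (bary i) a - 2) *: a = 0 by rewrite (alg _ (vertex i)) e subrr.
move=> /eqP; rewrite scaler_eq0 (negPf a0) orbF subr_eq0 => /eqP //.
Qed.

Lemma reflection_neq1 (g : PGL R n) : (1 <= n)%N -> is_proj_reflection g -> g != 1%g.
Proof.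
move=> n1 [h ->]; apply/eqP => /(congr1 (conjg^~ h^-1%g)).
rewrite /= conjgK conj1g => /pglP[c _] /matrixP e.
have := e 0 0; have := e (lift 0 (Ordinal n1)) (lift 0 (Ordinal n1)).
rewrite !mxE !eqxx /= !mulr1n => c1 c2; lra.
Qed.

End ReflectionLift.

Section ChartSign.
Context {R : realType} {n : nat}.
Implicit Types (f : 'rV[R]_n.+1) (Omega : set (proj_space R n)).

Lemma chart_ptN f x : chart_pt (- f) x = - chart_pt f x.
Proof.
by rewrite /chart_pt mulNmx mxE invrN scaleNr.
Qed.

Lemma convex_chartN f Omega : convex_set (chart_pt f @` Omega) ->
  convex_set (chart_pt (- f) @` Omega).
Proof.
move=> cO p q l; rewrite !inE => -[x Ox <-] [y Oy <-].
have := cO (chart_pt f x) (chart_pt f y) l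
  (mem_set (imageP _ Ox)) (mem_set (imageP _ Oy)).
rewrite inE => -[z Oz zE]; exists z => //.
by rewrite !chart_ptN zE !convex_lmodE opprD !scalerN.
Qed.

Lemma bounded_chartN f Omega : bounded_set (chart_pt f @` Omega) ->
  bounded_set (chart_pt (- f) @` Omega).
Proof.
move=> [M [Mr HM]]; exists M; split=> // M' /HM h _ [x Ox <-].
by rewrite /= chart_ptN normrN; apply: h; exists x.
Qed.

(** If the chart form had opposite signs at two vertices, it would vanish on the edge between them,
    inside [Omega]. Up to a global sign it is therefore positive at all vertices, which puts their
    chosen lifts in the cone. *)
Lemma exists_positive_form (B : GL R n) Omega :
  (forall c : 'cV[R]_n.+1, (forall i, 0 <= c i 0) -> c != 0 ->
    lifts Omega (val B *m c)) ->
  properly_convex Omega ->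
  exists f, [/\ Omega `<=` chart f, bounded_set (chart_pt f @` Omega),
    convex_set (chart_pt f @` Omega) & forall j, 0 < lform f (vertex B j)].
Proof.
move=> simpl [f [f0 Of bO cO]].
have fn0 (c : 'cV[R]_n.+1) : (forall i, 0 <= c i 0) -> c != 0 ->
    lform f (val B *m c) != 0.
  by move=> c0 cn0; have [x Ox vx] := simpl c c0 cn0; apply/(chartP f vx)/Of.
have dge0 (j k : 'I_n.+1) : 0 <= (delta_mx j 0 : 'cV[R]_n.+1) k 0.
  by rewrite mxE ler0n.
have dn0 (j : 'I_n.+1) : (delta_mx j 0 : 'cV[R]_n.+1) != 0.
  by apply/eqP => /colP/(_ j); rewrite !mxE !eqxx => /eqP; rewrite oner_eq0.
have same j k : 0 < lform f (vertex B j) -> 0 < lform f (vertex B k).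
  move=> fj; rewrite ltNge; apply/negP => fk.
  have {}fk : lform f (vertex B k) < 0 by rewrite lt_neqAle fk andbT fn0.
  pose c : 'cV[R]_n.+1 := - lform f (vertex B k) *: delta_mx j 0 +
    lform f (vertex B j) *: delta_mx k 0.
  have : lform f (val B *m c) != 0.
    apply: fn0 => [i|].
      rewrite mxE [X in X + _]mxE [X in _ + X]mxE.
      by rewrite addr_ge0// mulr_ge0// ltW// oppr_gt0.
    apply/eqP => /colP/(_ j); rewrite mxE [X in X + _]mxE [X in _ + X]mxE [RHS]mxE.
    have : 0 < - lform f (vertex B k) * (delta_mx j 0 : 'cV[R]_n.+1) j 0.
      by rewrite [X in _ * X]mxE !eqxx mulr1 oppr_gt0.
    have : 0 <= lform f (vertex B j) * (delta_mx k 0 : 'cV[R]_n.+1) j 0.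
      by rewrite mulr_ge0// ltW.
    lra.
  rewrite mulmxDr -!scalemxAr -!/(vertex B _) lformD !lformZ.
  by rewrite mulNr mulrC addNr eqxx.
have /orP[fneg|fpos] : (lform f (vertex B 0) < 0) || (0 < lform f (vertex B 0)).
  by rewrite -neq_lt; exact: fn0.
- exists (- f); split.
  + move=> x /Of /(chartP f (isrep_proj_vec x)) fx.
    apply/(chartP _ (isrep_proj_vec x)).
    by rewrite -scaleN1r lformZl mulN1r oppr_eq0.
  + exact: bounded_chartN.
  + exact: convex_chartN.
  + move=> j; rewrite -scaleN1r lformZl mulN1r oppr_gt0 ltNge; apply/negP => fj.
    have fj' : 0 < lform f (vertex B j) by rewrite lt_neqAle fj eq_sym fn0.
    by have := same j 0 fj'; rewrite ltNge ltW.
- by exists f; split=> // j; exact: same fpos.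
Qed.

End ChartSign.

(** * Invariance of the cone and signs of the reflection vectors *)

Section Domain.
Context {R : realType} {n : nat} {J : coxeter_diagram n}.
Context (hypJ : hyperbolic R J) (G : hyp_realization R J).
Context (B : GL R n) (rho : rep R J).
Local Notation Omega := (tiled_domain B rho).
Context (dom : convex_domain G rho Omega).

Lemma rep1 : rho 1%g = 1%g.
Proof.
have : (rho 1 * rho 1 = rho 1 * 1)%g by rewrite -gmulfM !mulg1.
exact: mulgI.
Qed.

Lemma rep_gen_sq i : (rho (cox_gen J i) * rho (cox_gen J i))%g = 1%g.
Proof.
rewrite -gmulfM -rep1; congr (rho _).
by rewrite [LHS]cox_mulE; apply/cox_wordP; exact: cox_eq_sq.
Qed.

Lemma simplex_sub_domain : simplex B `<=` Omega.
Proof. by move=> x Px; exists 1%g => //; exists x => //; rewrite rep1 pgl_act1. Qed.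

Lemma simplex_lifts (c : 'cV[R]_n.+1) :
  (forall i, 0 <= c i 0) -> c != 0 -> lifts Omega (val B *m c).
Proof.
move=> c0 cn0; have Bc0 : val B *m c != 0.
  by apply: contra_neq cn0 => Bc; rewrite -(mulKmx (valP B) c) Bc mulmx0.
have [x vx] := isrep_exists Bc0; exists x => //; apply: simplex_sub_domain.
by apply/cellP; exists c; split=> // i; rewrite inE.
Qed.

Context (n2 : (1 < n)%N).
Context (f : 'rV[R]_n.+1) (Of : Omega `<=` chart f).
Context (cO : convex_set (chart_pt f @` Omega)).
Context (fpos : forall j, 0 < lform f (vertex B j)).
Context (a : 'I_n.+1 -> 'cV[R]_n.+1).
Local Notation T i := (refl_mx B (a i) i).
Context (aP : forall i, [/\ reps (T i) (rho (cox_gen J i)), a i != 0 &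
  lform (bary B i) (a i) = 2]).
Local Notation K := (cone f Omega).
Local Notation beta i := (lform (bary B i)).

Lemma simplex_cone (c : 'cV[R]_n.+1) :
  (forall i, 0 <= c i 0) -> c != 0 -> K (val B *m c).
Proof.
move=> c0 cn0; split; first exact: simplex_lifts.
rewrite [c]matrix_sum_delta exchange_big /= zmodp.big_ord1 mulmx_sumr lform_sum.
have [k ck] : exists k, c k 0 != 0.
  apply/existsP; rewrite -[X in is_true X]negbK; apply: contra cn0 => /existsPn cz.
  by apply/eqP/colP => k; rewrite [RHS]mxE; apply/eqP; have := cz k; rewrite negbK.
rewrite (bigD1 k) //=; apply: ltr_wpDr; last first.
  by rewrite -scalemxAr lformZ mulr_gt0 ?fpos// lt_neqAle eq_sym ck c0.
by apply: sumr_ge0 => j _; rewrite -scalemxAr lformZ mulr_ge0// (ltW (fpos j)).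
Qed.

Lemma vertex_cone k : K (vertex B k).
Proof.
apply: simplex_cone => [j|]; first by rewrite mxE ler0n.
by apply/eqP => /colP/(_ k); rewrite !mxE !eqxx => /eqP; rewrite oner_eq0.
Qed.

Lemma refl_bary i v : beta i (T i *m v) = - beta i v.
Proof.
by have [_ _ a2] := aP i; rewrite refl_mxE lformB lformZ a2; ring.
Qed.

Lemma refl_vertex i j : j != i -> T i *m vertex B j = vertex B j.
Proof.
by move=> ji; rewrite refl_mxE bary_vertex eq_sym (negPf ji) scale0r subr0.
Qed.

Lemma reflK i (v : 'cV[R]_n.+1) : T i *m (T i *m v) = v.
Proof.
rewrite refl_mxE refl_bary refl_mxE; set b := beta i v.
by rewrite scaleNr opprK subrK.
Qed.

Lemma lifts_act g (M : 'M[R]_n.+1) v :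
  reps M (rho g) -> lifts Omega v -> lifts Omega (M *m v).
Proof.
move=> Mg [x Ox vx]; exists (pgl_act (rho g) x); last exact: isrep_act.
by have [_ _ inv _] := dom; rewrite -(inv g); exists x.
Qed.

(** The lift preserves the union of the two opposite cones, and by [cone_sign] it either preserves
    or exchanges them; a vertex other than the i-th is fixed, which excludes the exchange. *)
Lemma refl_cone i v : K v -> K (T i *m v).
Proof.
have [Ti _ _] := aP i; move=> [Ov fv]; split; first exact: lifts_act Ti Ov.
have OfT : Omega `<=` chart (f *m T i).
  move=> x Ox; apply/(chartP _ (isrep_proj_vec x)).
  have [y Oy wy] : lifts Omega (T i *m proj_vec x).
    by apply: lifts_act Ti _; exists x => //; exact: isrep_proj_vec.
  by have /(chartP _ wy) := Of Oy; rewrite /lform mulmxA.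
have [pos|neg] := cone_sign cO OfT.
  by have := pos v (conj Ov fv); rewrite /lform mulmxA.
have [k ki] : exists k : 'I_n.+1, k != i.
  by exists (lift i (Ordinal (ltnW n2))); rewrite eq_sym neq_lift.
have := neg _ (vertex_cone k); rewrite /lform -mulmxA refl_vertex// => /lt_gtF.
by rewrite [X in X = _](fpos k).
Qed.

Lemma cone_isrep x : Omega x -> exists2 v, K v & isrep v x.
Proof.
by move=> Ox; exists (chart_pt f x); [exact: cone_chart_pt|exact/isrep_chart_pt/Of].
Qed.

(* The equivariant homeomorphism maps the mirror of [tau_k] in hyperbolic space
   to the hyperplane [beta k = 0] and its sides to the sides of that hyperplane;
   the sign of [beta i (a j)] is read off at the reflected vertex
   [T j *m vertex B j]. *)
Lemma refl_off_diag_le0 i j : i != j -> beta i (a j) <= 0.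
Proof.
move=> ij; have [oO _ inv [h [hc [hO hI hS] [hinv _ hK]] heq]] := dom.
have hOm q : Omega (h q) by exact: hO.
pose l k q := lorentz (hyp_vec q) (hr_normal G k).
pose psi k (q : hyp R n) := beta k (proj_vec (h q)) / lform f (proj_vec (h q)).
have psi_cont k : continuous (psi k).
  move=> q; apply: (@continuous_comp _ _ _ h
    (fun y => beta k (proj_vec y) / lform f (proj_vec y))); first exact: hc.
  by apply: chart_ratio_continuous; exact: Of.
have psiE k q v : K v -> isrep v (h q) -> psi k q = beta k v / lform f v.
  move=> [_ fv] [c c0 vE]; move: fv; rewrite /psi vE !lformZ => fv.
  by rewrite -mulf_div mulfV// mul1r.
have nrm0 k : hr_normal G k != 0.
  apply/eqP => nk; have := hr_gram G k k.
  by rewrite nk lorentz_bform /bform mulmx0 !mxE eqxx => /eqP; rewrite eq_sym oner_eq0.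
have rep_refl k q v : isrep v (h q) -> isrep (T k *m v) (h (hr_act G (cox_gen J k) q)).
  by have [Tk _ _] := aP k; move=> vq; rewrite heq; exact: isrep_act.
have l_refl k j' q :
    l k (hr_act G (cox_gen J j') q) = l k q - 2 * l j' q * cartan R J j' k.
  rewrite /l hr_act_gen lorentz_bform bformBl bformZl -!lorentz_bform.
  by rewrite hr_gram.
(* Both conditions say that [q] is fixed by the k-th generator. In the forward direction the lift
   gives T v = c v with c > 0 by invariance of the cone, while beta changes sign, so beta
   vanishes. *)
have l0P k q : l k q = 0 <-> psi k q = 0.
  have [v Kv vq] := cone_isrep (hOm q); have [_ a0 _] := aP k.
  have fv : 0 < lform f v by case: Kv.
  rewrite (psiE k q v)//; split=> [lk|].
    have e : hr_act G (cox_gen J k) q = q.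
      apply: hyp_vec_inj; rewrite hr_act_gen -/(l k q) lk mulr0 scale0r subr0//.
    have := rep_refl k q v vq; rewrite e => /(isrep_colinear vq)[c c0 Tv].
    have : beta k (c *: v) = - beta k v by rewrite -Tv refl_bary.
    have Kc : K (c *: v) by rewrite -Tv; exact: refl_cone.
    have cp : 0 < c by case: Kc => _; rewrite lformZ pmulr_lgt0.
    rewrite lformZ => h1.
    have : (c + 1) * beta k v = 0 by rewrite mulrDl h1 mul1r addNr.
    move=> /eqP; rewrite mulf_eq0 gt_eqF ?addr_gt0//= => /eqP ->.
    by rewrite mul0r.
  move=> /eqP; rewrite mulf_eq0 invr_eq0 (gt_eqF fv) orbF => /eqP bv.
  have Tv : T k *m v = v by rewrite refl_mxE bv scale0r subr0.
  have := rep_refl k q v vq; rewrite Tv => /(isrep_inj vq)/esym e.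
  have hinj : h (hr_act G (cox_gen J k) q) = h q by [].
  have := congr1 hinv hinj; rewrite !hK => /(congr1 (@hyp_vec R n)).
  rewrite hr_act_gen => /eqP; rewrite -subr_eq0 addrAC subrr add0r oppr_eq0.
  rewrite scaler_eq0 (negPf (nrm0 k)) orbF mulf_eq0 pnatr_eq0 /= => /eqP //.
have vert k : exists q, isrep (vertex B k) (h q).
  have Kk : K (vertex B k) by exact: vertex_cone.
  have [[x Ox vx] _] := Kk; have [q _ hq] := hS x Ox.
  by exists q; rewrite hq.
have [q qv] := choice vert.
have Kvert k : K (vertex B k) by exact: vertex_cone.
have psi_q k m : psi m (q k) = (m == k)%:R / lform f (vertex B k).
  by rewrite (psiE m (q k) (vertex B k))// bary_vertex.
have qE k m : m != k -> l m (q k) = 0.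
  by move=> mk; apply/l0P; rewrite psi_q (negPf mk) mul0r.
have psi_q0 k : 0 < psi k (q k).
  by rewrite psi_q eqxx mul1r invr_gt0.
have s0 k : l k (q k) != 0.
  by apply/eqP => /l0P e; have := psi_q0 k; rewrite e ltxx.
(* The function psi_k has no zero off the k-th mirror, so its sign is constant on the side
   containing [q k], where it is positive. *)
have side k p : 0 < l k (q k) * l k p -> 0 < psi k p.
  move=> lp; rewrite -(pmulr_rgt0 _ (psi_q0 k)).
  apply: (half_space_sign (w := - l k (q k) *: hr_normal G k)) => //.
  - move=> z; rewrite lorentz_bform bformZr -lorentz_bform -/(l k z) => lz.
    apply/eqP => /l0P e; by rewrite e mulr0 ltxx in lz.
  - rewrite lorentz_bform bformZr -lorentz_bform -/(l k _) mulNr oppr_lt0.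
    by rewrite -expr2 exprn_even_gt0//=.
  - by rewrite lorentz_bform bformZr -lorentz_bform -/(l k _) mulNr oppr_lt0.
(* The homeomorphism is not known to match the two simplices, so the sign of l_k(q_k) is unknown;
   that it is the same for [i] and [j] places the reflected vertex [p] on the side of [q i], or on
   the mirror when the Cartan entry is 0. *)
have sij : 0 < l i (q i) * l j (q j) by exact: vertex_sign.
set p := hr_act G (cox_gen J j) (q j).
have lp : l i p = - 2 * l j (q j) * cartan R J j i.
  by rewrite /p l_refl qE// sub0r !mulNr.
have psip : psi i p = - beta i (a j) / lform f (T j *m vertex B j).
  rewrite (psiE i p (T j *m vertex B j)); first last.
  - exact: rep_refl.
  - exact: refl_cone.
  congr (_ / _); rewrite refl_mxE lformB lformZ !bary_vertex (negPf ij) eqxx.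
  by rewrite mul1r sub0r.
have fT : 0 < lform f (T j *m vertex B j) by have [] := refl_cone j (Kvert j).
have C0 : cartan R J j i <= 0 by apply: cartan_offdiag_le0; rewrite eq_sym.
have psi0 : 0 <= psi i p.
  have [C00|Cn0] := eqVneq (cartan R J j i) 0.
    by have /l0P -> : l i p = 0 by rewrite lp C00 mulr0.
  apply/ltW/side; rewrite lp.
  have -> : l i (q i) * (-2 * l j (q j) * cartan R J j i) =
    (l i (q i) * l j (q j)) * (2 * - cartan R J j i) by ring.
  by rewrite mulr_gt0// mulr_gt0// oppr_gt0 lt_neqAle Cn0.
by move: psi0; rewrite psip pmulr_lge0 ?invr_gt0// oppr_ge0.
Qed.

End Domain.

(** * Averaging over a parabolic subgroup *)

Section Words.
Context {T : eqType}.

Fixpoint words (s : seq T) (N : nat) : seq (seq T) :=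
  if N is N'.+1 then [::] :: [seq x :: w | x <- s, w <- words s N'] else [:: [::]].

Lemma mem_words (s : seq T) N u :
  (u \in words s N) = all (mem s) u && (size u <= N)%N.
Proof.
elim: N u => [|N ih] [|x u] //=; rewrite !inE //= ?andbF//.
apply/allpairsP/andP => [[[y w] /= [ys wN [-> ->]]]|[/andP[xs us] uN]].
  by move: wN; rewrite ih => /andP[ws wN]; split=> //; apply/andP.
by exists (x, u); split=> //=; rewrite ih us.
Qed.

End Words.

Section Average.
Context {R : realType} {n : nat} (B : GL R n) (a : 'I_n.+1 -> 'cV[R]_n.+1).
Context (F : {set 'I_n.+1}) (N : nat).
Local Notation T i := (refl_mx B (a i) i).
Local Notation beta i := (lform (bary B i)).

Definition word_mx (u : seq 'I_n.+1) : 'M[R]_n.+1 :=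
  foldr (fun i M => T i *m M) 1%:M u.

Lemma word_mx_rcons u i : word_mx (rcons u i) = word_mx u *m T i.
Proof.
by elim: u => [|j u ih] /=; [rewrite mul1mx mulmx1|rewrite ih mulmxA].
Qed.

Context (a2 : forall i, beta i (a i) = 2) (a0 : forall i, a i != 0).
Context (wordN : forall u, all (mem F) u ->
  exists v, [/\ all (mem F) v, (size v <= N)%N & word_mx u = word_mx v]).

Lemma refl_mx_sq i : T i *m T i = 1%:M.
Proof.
apply: (mul_vertex_ext (B := B)) => j; rewrite -mulmxA mul1mx.
rewrite !refl_mxE lformB lformZ a2.
move: (vertex B j) (lform _ (vertex B j)) (a i) => b t c.
by apply/colP => k; rewrite !mxE; ring.
Qed.

(** The finite matrix group generated by the reflections of [F]. Repetitions are removed so that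
    multiplication by a generator permutes the list. *)
Definition word_mxs : seq 'M[R]_n.+1 := undup [seq word_mx u | u <- words (enum F) N].

Lemma word_mxsP M : reflect (exists2 u, all (mem F) u & M = word_mx u) (M \in word_mxs).
Proof.
have memF u : all (mem (enum F)) u = all (mem F) u.
  by apply: eq_all => i; rewrite /= mem_enum.
rewrite mem_undup; apply: (iffP mapP) => [[u]|[u uF ->]].
  by rewrite mem_words memF => /andP[uF _] ->; exists u.
have [v [vF vN ->]] := wordN uF; exists v => //.
by rewrite mem_words memF vF.
Qed.

Lemma word_mxs_perm (g : 'M[R]_n.+1 -> 'M[R]_n.+1) : injective g ->
  (forall M, M \in word_mxs -> g M \in word_mxs) ->
  perm_eq [seq g M | M <- word_mxs] word_mxs.
Proof.
move=> ginj gS; apply: uniq_perm; rewrite ?undup_uniq ?map_inj_uniq ?undup_uniq//.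
have [|||_ eqm //] := uniq_min_size (s1 := [seq g M | M <- word_mxs]) (s2 := word_mxs).
- by rewrite map_inj_uniq ?undup_uniq.
- by move=> _ /mapP[M MS ->]; exact: gS.
- by rewrite size_map.
Qed.

Lemma word_mxs_mull i : i \in F ->
  perm_eq [seq T i *m M | M <- word_mxs] word_mxs.
Proof.
move=> iF; apply: word_mxs_perm.
  by move=> M M' /(congr1 (mulmx (T i))); rewrite !mulmxA refl_mx_sq !mul1mx.
move=> _ /word_mxsP[u uF ->]; apply/word_mxsP; exists (i :: u) => //=.
by rewrite iF.
Qed.

Lemma word_mxs_mulr i : i \in F ->
  perm_eq [seq M *m T i | M <- word_mxs] word_mxs.
Proof.
move=> iF; apply: (word_mxs_perm (g := mulmxr (T i))).
  move=> M M' /(congr1 (mulmxr (T i))).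
  by rewrite /= -!mulmxA refl_mx_sq !mulmx1.
move=> _ /word_mxsP[u uF ->]; apply/word_mxsP; exists (rcons u i).
  by rewrite all_rcons uF /= iF.
by rewrite word_mx_rcons.
Qed.

Lemma word_mxs1 : 1%:M \in word_mxs.
Proof. by apply/word_mxsP; exists [::]. Qed.

(** Proportional to the average, hence the same projective point. *)
Definition orbit_sum (x : 'cV[R]_n.+1) : 'cV[R]_n.+1 := \sum_(M <- word_mxs) M *m x.

Lemma orbit_sum_fixed i x : i \in F -> beta i (orbit_sum x) = 0.
Proof.
move=> iF; have Tp : T i *m orbit_sum x = orbit_sum x.
  rewrite /orbit_sum mulmx_sumr -[RHS](perm_big _ (word_mxs_mull iF)) big_map /=.
  by apply: eq_bigr => M _; rewrite mulmxA.
move: Tp; rewrite refl_mxE => /eqP; rewrite subr_eq -subr_eq0 opprD addrA subrr add0r.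
by rewrite oppr_eq0 scaler_eq0 (negPf (a0 i)) orbF => /eqP.
Qed.

(** The standard inner product averaged over the group, up to a factor: an invariant inner
    product. *)
Definition avg_form : 'M[R]_n.+1 := \sum_(M <- word_mxs) M^T *m M.

Lemma avg_formE x y : bform avg_form x y =
  \sum_(M <- word_mxs) \sum_k (M *m x) k 0 * (M *m y) k 0.
Proof.
rewrite /bform /avg_form mulmx_sumr mulmx_suml summxE; apply: eq_bigr => M _.
rewrite !mulmxA -mulmxA -trmx_mul mxE; apply: eq_bigr => k _.
by rewrite !mxE.
Qed.

Lemma avg_form_inv i x y : i \in F ->
  bform avg_form (T i *m x) (T i *m y) = bform avg_form x y.
Proof.
move=> iF; rewrite !avg_formE -[RHS](perm_big _ (word_mxs_mulr iF)) big_map /=.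
by apply: eq_bigr => M _; rewrite !mulmxA.
Qed.

(** Invariance makes [a i] orthogonal to its mirror, so products with [a i] have the sign of the
    i-th barycentric coordinate. *)
Lemma avg_form_refl i x : i \in F ->
  2 * bform avg_form (a i) x = beta i x * bform avg_form (a i) (a i).
Proof.
move=> iF; have := avg_form_inv (a i) x iF.
rewrite !refl_mxE a2 bformBl !bformBr !bformZl !bformZr; lra.
Qed.

Lemma avg_form_ge0 x : 0 <= bform avg_form x x.
Proof.
rewrite avg_formE; apply: sumr_ge0 => M _; apply: sumr_ge0 => k _.
by rewrite -expr2 sqr_ge0.
Qed.

Lemma avg_form_le0 x : bform avg_form x x <= 0 -> x = 0.
Proof.
rewrite avg_formE (perm_big _ (perm_to_rem word_mxs1)) big_cons /= mul1mx => le0.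
have ge1 : 0 <= \sum_(M <- rem 1%:M word_mxs) \sum_k (M *m x) k 0 * (M *m x) k 0.
  by apply: sumr_ge0 => M _; apply: sumr_ge0 => k _; rewrite -expr2 sqr_ge0.
have sq0 k : true -> 0 <= x k 0 * x k 0 by move=> _; rewrite -expr2 sqr_ge0.
have : \sum_k x k 0 * x k 0 = 0.
  apply/eqP; rewrite eq_le sumr_ge0 ?andbT//.
  by apply: le_trans le0; rewrite lerDl.
move=> /(psumr_eq0P sq0) x0; apply/colP => k; rewrite [RHS]mxE.
by have /eqP := x0 k isT; rewrite mulf_eq0 orbb => /eqP.
Qed.

Definition normal_mx : 'M[R]_n.+1 := \matrix_(k, j) a j k 0.

Lemma normal_mx_delta i : normal_mx *m delta_mx i 0 = a i.
Proof. by rewrite -colE; apply/colP => j; rewrite !mxE. Qed.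

Lemma normal_mx_mul c : normal_mx *m c = \sum_j c j 0 *: a j.
Proof.
apply/colP => i; rewrite mxE summxE; apply: eq_bigr => j _.
by rewrite !mxE mulrC.
Qed.

Lemma word_mx_shift u x : all (mem F) u ->
  exists2 c, supported F c & word_mx u *m x = x - normal_mx *m c.
Proof.
elim: u => [|i u ih] /=.
  by move=> _; exists 0; [move=> i _; rewrite mxE|rewrite mul1mx mulmx0 subr0].
move=> /andP[iF /ih[c cF e]].
exists (c + beta i (word_mx u *m x) *: delta_mx i 0).
  move=> j jF; rewrite mxE (cF _ jF) add0r mxE [X in _ * X]mxE.
  have -> : (j == i) = false by apply: contraNF jF => /eqP ->.
  by rewrite mulr0.
rewrite -mulmxA refl_mxE [in LHS]e mulmxDr -scalemxAr normal_mx_delta opprD addrA.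
by rewrite e.
Qed.

Lemma orbit_sum_shift x :
  exists2 c, supported F c & orbit_sum x = (size word_mxs)%:R *: x - normal_mx *m c.
Proof.
have: {subset word_mxs <= word_mxs} by [].
rewrite /orbit_sum; move: {1 3 4}word_mxs; elim=> [|M s ih] sub.
  exists 0; first by move=> i _; rewrite mxE.
  by rewrite big_nil scale0r mulmx0 subr0.
have [|c cF e] := ih; first by move=> M' M's; apply: sub; rewrite inE M's orbT.
have /word_mxsP[u uF Mu] := sub M (mem_head _ _).
have [c' cF' e'] := word_mx_shift x uF.
exists (c' + c); first by move=> i iF; rewrite mxE cF'// cF// addr0.
rewrite big_cons e Mu e' /= -natr1 scalerDl scale1r mulmxDr opprD addrACA.
by rewrite [x + _]addrC.
Qed.

Context (aneg : forall i j, i != j -> beta i (a j) <= 0).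

(* The shift vector of the orbit sum is a combination of the [a j] which has a
   nonnegative product with each of them; the [a j] being pairwise obtuse for an
   invariant inner product, the coefficients may be taken nonnegative. *)
Lemma orbit_sum_ge0 x k : (forall i, 0 <= beta i x) -> 0 <= beta k (orbit_sum x).
Proof.
move=> x0; have [kF|kF] := boolP (k \in F); first by rewrite orbit_sum_fixed.
have [c cF e] := orbit_sum_shift x.
pose A := normal_mx^T *m avg_form *m normal_mx.
have AE i j : A i j = bform avg_form (a i) (a j).
  by rewrite -bform_delta bform_congr !normal_mx_delta.
have aa i : 0 <= bform avg_form (a i) (a i) by exact: avg_form_ge0.
(* The a_j are not known to be independent, so their Gram matrix [A] is only semidefinite; it is the
   combination with coefficients [negpart c] that vanishes, and not the coefficients. *)
have neg0 : normal_mx *m negpart c = 0.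
  apply: avg_form_le0; rewrite -bform_congr; apply: (@negpart_bform_le0 _ _ _ F) => //.
    move=> i j iF jF ij; rewrite AE -(pmulr_rle0 _ (ltr0n _ 2)) avg_form_refl//.
    by apply: mulr_le0_ge0; [exact: aneg|exact: aa].
  move=> i iF; have -> : (A *m c) i 0 = bform avg_form (a i) (normal_mx *m c).
    by rewrite -[in RHS](normal_mx_delta i) -bform_congr bform_deltal.
  rewrite -(pmulr_rge0 _ (ltr0n _ 2)) avg_form_refl// mulr_ge0//.
  have : beta i (orbit_sum x) = 0 by exact: orbit_sum_fixed.
  rewrite e lformB lformZ => /eqP; rewrite subr_eq0 => /eqP <-.
  by rewrite mulr_ge0// ler0n.
(* For [k] outside [F], the form beta_k is nonpositive on each a_j with j in [F], so subtracting
   their nonnegative combination can only increase beta_k. *)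
rewrite e {1}(posnegE c) mulmxBr neg0 subr0 lformB lformZ subr_ge0.
apply: (@le_trans _ _ 0); last by rewrite mulr_ge0// ler0n.
rewrite normal_mx_mul lform_sum; apply: sumr_le0 => j _; rewrite lformZ.
have [jF|jF] := boolP (j \in F); last by rewrite mxE (cF _ jF) maxxx mul0r.
rewrite mulr_ge0_le0//; first by rewrite mxE le_max lexx orbT.
by apply: aneg; apply: contraNneq kF => ->.
Qed.

End Average.

(** * From the order to the distance between a point and a cell *)

Section CellDistance.
Context {R : realType} {n : nat} {J : coxeter_diagram n}.
Context (hypJ : hyperbolic R J) (G : hyp_realization R J).
Context (B : GL R n) (rho : rep R J).
Local Notation Omega := (tiled_domain B rho).
Context (dom : convex_domain G rho Omega).
Context (n2 : (1 < n)%N).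
Context (f : 'rV[R]_n.+1) (Of : Omega `<=` chart f).
Context (bO : bounded_set (chart_pt f @` Omega)).
Context (cO : convex_set (chart_pt f @` Omega)).
Context (fpos : forall j, 0 < lform f (vertex B j)).
Context (a : 'I_n.+1 -> 'cV[R]_n.+1).
Local Notation T i := (refl_mx B (a i) i).
Context (aP : forall i, [/\ reps (T i) (rho (cox_gen J i)), a i != 0 &
  lform (bary B i) (a i) = 2]).
Local Notation K := (cone f Omega).
Local Notation Kc := (closed_cone f Omega).
Local Notation beta i := (lform (bary B i)).

Lemma reps_word_mx u : reps (word_mx B a u) (rho (cox_word J u)).
Proof.
elim: u => [|i u ih] /=.
  by rewrite [cox_word J [::]](_ : _ = 1%g)// rep1; exact: reps1.
have -> : cox_word J (i :: u) = (cox_gen J i * cox_word J u)%g.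
  by rewrite [RHS]cox_mulE.
by rewrite gmulfM; apply: repsM => //; have [] := aP i.
Qed.

Lemma word_mx_vertex (S : {set 'I_n.+1}) u j : all (mem (~: S)) u -> j \in S ->
  word_mx B a u *m vertex B j = vertex B j.
Proof.
move=> + jS; elim: u => [|i u ih] /=; first by rewrite mul1mx.
move=> /andP[iS /ih {}ih]; rewrite -mulmxA ih refl_vertex//.
by apply: contraTneq iS => <-; rewrite inE jS.
Qed.

(* Projectively equal products agree, as they fix a common vertex. *)
Lemma word_mx_eq (S : {set 'I_n.+1}) u v j : j \in S ->
  all (mem (~: S)) u -> all (mem (~: S)) v -> cox_eq J u v ->
  word_mx B a u = word_mx B a v.
Proof.
move=> jS uS vS /cox_wordP uv.
have := reps_word_mx v; rewrite -uv => /(reps_proportional (reps_word_mx u))[c c0 e].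
have := word_mx_vertex vS jS; rewrite e -scalemxAl (word_mx_vertex uS jS).
move=> /(congr1 (beta j)); rewrite lformZ bary_vertex eqxx mulr1 => ->.
by rewrite scale1r.
Qed.

Lemma refl_closed_cone i w : Kc w -> Kc (T i *m w).
Proof.
move=> Kw z Kz; rewrite -[z](reflK aP i) -mulmxDr.
by apply: (refl_cone dom) => //; apply: Kw; exact: (refl_cone dom).
Qed.

Lemma word_mx_cone u v : K v -> K (word_mx B a u *m v).
Proof.
move=> Kv; elim: u => [|i u ih] /=; first by rewrite mul1mx.
by rewrite -mulmxA; exact: (refl_cone dom).
Qed.

Lemma closed_cone_sum (I : eqType) (s : seq I) (w : I -> 'cV[R]_n.+1) :
  (forall i, i \in s -> Kc (w i)) -> Kc (\sum_(i <- s) w i).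
Proof.
elim: s => [|i s ih] Kw; first by rewrite big_nil; exact: closed_cone0.
rewrite big_cons; apply: closed_coneD; first by apply: Kw; rewrite mem_head.
by apply: ih => j js; apply: Kw; rewrite inE js orbT.
Qed.

Lemma cone_sum (I : eqType) (s : seq I) (w : I -> 'cV[R]_n.+1) i0 : i0 \in s ->
  (forall i, i \in s -> K (w i)) -> K (\sum_(i <- s) w i).
Proof.
move=> i0s Kw; rewrite (perm_big _ (perm_to_rem i0s)) big_cons.
apply: closed_cone_sum; last exact: Kw.
by move=> i /mem_rem si; apply: cone_closed_cone => //; exact: Kw.
Qed.

Context (S : {set 'I_n.+1}) (e : 'I_n.+1) (eS : e \in S) (N : nat).
Context (SN : words_bounded J (~: S) N).

Lemma word_mx_bounded u : all (mem (~: S)) u ->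
  exists v, [/\ all (mem (~: S)) v, (size v <= N)%N & word_mx B a u = word_mx B a v].
Proof.
move=> uS; have [v [vS vN uv]] := SN uS.
by exists v; split=> //; exact: (word_mx_eq eS uS vS uv).
Qed.

(** Here [S] indexes the vertices of the common cell, [i0] is the only index outside [S] at which
    [v] may have a nonzero coordinate, and w <= c v <= r w in the cone order. *)
Context (v w : 'cV[R]_n.+1) (i0 : 'I_n.+1).
Context (vpos : forall i, 0 <= beta i v) (Kv : K v).
Context (v0 : forall i, i \notin S -> i != i0 -> beta i v = 0) (w0 : beta i0 w = 0).
Context (c r : R) (c0 : 0 < c) (r1 : 1 <= r).
Context (vw : Kc (c *: v - w)) (wv : Kc (r *: w - c *: v)).

(* [T i0] fixes [w], which lies between two multiples of [v]. *)
Lemma refl_order i : i \notin S ->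
  Kc (r *: (T i *m v) - v) /\ Kc (r *: v - T i *m v).
Proof.
move=> iS; have r0 : 0 < r := lt_le_trans ltr01 r1.
suff H : Kc (r *: (T i *m v) - v).
  split=> //; rewrite -[X in Kc (r *: X - _)](reflK aP i) scalemxAr -mulmxBr.
  exact: refl_closed_cone.
have [->|ii0] := eqVneq i i0; last first.
  rewrite refl_mxE v0// scale0r subr0 -{2}[v]scale1r -scalerBl.
  have [->|rn1] := eqVneq r 1; first by rewrite subrr scale0r; exact: closed_cone0.
  apply: closed_coneZ; first by rewrite subr_gt0 lt_neqAle eq_sym rn1.
  exact: cone_closed_cone.
have Tw : T i0 *m w = w by rewrite refl_mxE w0 scale0r subr0.
have KT := refl_closed_cone i0 vw; rewrite mulmxBr Tw -scalemxAr in KT.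
have -> : r *: (T i0 *m v) - v =
    (r / c) *: (c *: (T i0 *m v) - w) + c^-1 *: (r *: w - c *: v).
  move: (T i0 *m v) => u; rewrite !scalerBr !scalerA divfK ?gt_eqF//.
  by rewrite mulVf ?gt_eqF// scale1r addrA (mulrC c^-1) subrK.
apply: closed_coneD; apply: closed_coneZ => //; first exact: divr_gt0.
by rewrite invr_gt0.
Qed.

(** A multiplicative triangle inequality: apply the first letter to the comparison for the rest of
    the word, then compare its image of [v] with [v], at the cost of one more factor [r]. *)
Lemma word_order u : all (mem (~: S)) u ->
  Kc (r ^+ size u *: (word_mx B a u *m v) - v) /\
  Kc (r ^+ size u *: v - word_mx B a u *m v).
Proof.
have r0 : 0 < r := lt_le_trans ltr01 r1.
elim: u => [|i u ih] /=.
  by rewrite mul1mx expr0 scale1r subrr; split; exact: closed_cone0.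
move=> /andP[]; rewrite inE => iS /ih[ih1 ih2]; have [H1 H2] := refl_order iS.
rewrite -mulmxA; set y := word_mx B a u *m v in ih1 ih2 *.
have /(refl_closed_cone i) := ih1; have /(refl_closed_cone i) := ih2.
rewrite !mulmxBr -!scalemxAr => K2 K1; split.
  have -> : r ^+ (size u).+1 *: (T i *m y) - v =
      r *: (r ^+ size u *: (T i *m y) - T i *m v) + (r *: (T i *m v) - v).
    by rewrite scalerBr scalerA -exprS addrA subrK.
  by apply: closed_coneD => //; exact: closed_coneZ.
have -> : r ^+ (size u).+1 *: v - T i *m y =
    r ^+ size u *: (r *: v - T i *m v) + (r ^+ size u *: (T i *m v) - T i *m y).
  by rewrite scalerBr scalerA -exprSr addrA subrK.
by apply: closed_coneD => //; apply: closed_coneZ => //; exact: exprn_gt0.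
Qed.

(** Replacing the word by a short one with the same matrix makes the exponent uniform, as r >= 1. *)
Lemma word_order_bounded M : M \in word_mxs B a (~: S) N ->
  Kc (r ^+ N *: (M *m v) - v) /\ Kc (r ^+ N *: v - M *m v).
Proof.
have r0 : 0 < r := lt_le_trans ltr01 r1.
move=> /(word_mxsP word_mx_bounded)[u uS ->].
have [u' [u'S u'N ->]] := word_mx_bounded uS.
have [H1 H2] := word_order u'S.
have mono y z : K y -> Kc (r ^+ size u' *: y - z) -> Kc (r ^+ N *: y - z).
  move=> Ky H; have -> : r ^+ N *: y - z =
      (r ^+ N - r ^+ size u') *: y + (r ^+ size u' *: y - z).
    by rewrite scalerBl addrA subrK.
  apply: closed_coneD => //.
  have : r ^+ size u' <= r ^+ N by rewrite ler_weXn2l.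
  rewrite le_eqVlt => /orP[/eqP ->|lt].
    by rewrite subrr scale0r; exact: closed_cone0.
  by apply: closed_coneZ; [rewrite subr_gt0|exact: cone_closed_cone].
by split; apply: mono => //; exact: word_mx_cone.
Qed.

(** Adding the comparisons over the [m] elements of the group gives m v <= r^N p and p <= m r^N v
    for the orbit sum p, hence v <= (r^N / m) p <= (r^N)^2 v. *)
Lemma cell_close x : isrep v x ->
  exists2 z, cell B S z & hilbert_dist Omega x z <= N%:R * ln r.
Proof.
move=> vx; have r0 : 0 < r := lt_le_trans ltr01 r1.
have oO : open Omega by case: dom.
have a2 i : beta i (a i) = 2 by case: (aP i).
have a0 i : a i != 0 by case: (aP i).
pose Ms := word_mxs B a (~: S) N; pose p := orbit_sum B a (~: S) N v.
have M1 : 1%:M \in Ms by exact: (word_mxs1 word_mx_bounded).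
have Kp : K p.
  apply: (cone_sum M1) => M /(word_mxsP word_mx_bounded)[u uS ->].
  exact: word_mx_cone.
have [z pz] : exists z, isrep p z by have [[z _ pz] _] := Kp; exists z.
pose m : R := (size Ms)%:R.
have m0 : 0 < m by rewrite ltr0n; case: (Ms) M1.
have sumB (q : R) : \sum_(M <- Ms) (q *: v - M *m v) = (m * q) *: v - p.
  rewrite big_split /= sumrN /p; congr (_ - _).
  by rewrite big_const_seq count_predT iter_addr_0 /m -scaler_nat scalerA.
have sumB' (q : R) : \sum_(M <- Ms) (q *: (M *m v) - v) = q *: p - m *: v.
  rewrite big_split /= sumrN -scaler_sumr; congr (_ - _).
  by rewrite big_const_seq count_predT iter_addr_0 /m -scaler_nat.
have Kp1 : Kc ((m * r ^+ N) *: v - p).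
  by rewrite -sumB; apply: closed_cone_sum => M /word_order_bounded[].
have Kp2 : Kc (r ^+ N *: p - m *: v).
  by rewrite -sumB'; apply: closed_cone_sum => M /word_order_bounded[].
exists z.
  apply/cellP; exists (invmx (val B) *m p); split.
  - move=> i; rewrite -lform_bary.
    apply: orbit_sum_ge0; [exact: a2|exact: a0|exact: word_mx_bounded| |exact: vpos].
    move=> k l; exact: (refl_off_diag_le0 hypJ dom n2 Of cO fpos aP).
  - move=> i iS; rewrite -lform_bary.
    by apply: (orbit_sum_fixed a2 a0 word_mx_bounded); rewrite inE.
  - by rewrite mulKVmx// (valP B).
have -> : N%:R * ln r = 2^-1 * ln ((r ^+ N) ^+ 2).
  rewrite lnXn ?exprn_gt0// -[ln _ *+ 2]mulr_natl mulKf ?pnatr_eq0//.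
  by rewrite lnXn// mulr_natl.
have rN0 : 0 < r ^+ N by exact: exprn_gt0.
apply: (hilbert_dist_le oO Of bO cO vx pz Kv Kp (c := r ^+ N / m)).
- exact: divr_gt0.
- exact: exprn_gt0.
- have -> : (r ^+ N / m) *: p - v = m^-1 *: (r ^+ N *: p - m *: v).
    by rewrite scalerBr !scalerA mulVf ?gt_eqF// scale1r mulrC.
  by apply: closed_coneZ => //; rewrite invr_gt0.
- have -> : (r ^+ N) ^+ 2 *: v - (r ^+ N / m) *: p =
      (r ^+ N / m) *: ((m * r ^+ N) *: v - p).
    rewrite scalerBr !scalerA; congr (_ *: _ - _).
    by field; rewrite gt_eqF.
  by apply: closed_coneZ => //; rewrite divr_gt0.
Qed.

End CellDistance.

(** * The cells of the simplex *)

Lemma cell_vertex (R : realType) n (B : GL R n) (S : {set 'I_n.+1}) j x :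
  isrep (vertex B j) x -> cell B S x <-> j \in S.
Proof.
move=> jx; split.
  move=> /cellP[c [_ cS cx]]; have [l l0 e] := isrep_colinear cx jx.
  apply: contraTT isT => jS; move: (congr1 (lform (bary B j)) e).
  rewrite bary_vertex eqxx lformZ lform_bary_mul (cS j jS) mulr0 => /eqP.
  by rewrite oner_eq0.
move=> jS; apply/cellP; exists (delta_mx j 0); split=> // i.
  by rewrite mxE ler0n.
by move=> iS; rewrite mxE; case: eqVneq iS => [->|//]; rewrite jS.
Qed.

(** A cell determines its set of vertices, so membership is tested at the vertices alone. *)
Lemma cellI_set (R : realType) n (B : GL R n) (S1 S2 S3 : {set 'I_n.+1}) :
  cell B S1 `&` cell B S2 = cell B S3 -> S3 = S1 :&: S2.
Proof.
move=> e; apply/setP => j; rewrite inE.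
have [x jx] : exists x, isrep (vertex B j) x.
  apply: isrep_exists; apply: contraTneq isT => v0.
  have := bary_vertex B j j; rewrite v0 lform0 eqxx => /eqP.
  by rewrite eq_sym oner_eq0.
have [i1 o1] := cell_vertex S1 jx; have [i2 o2] := cell_vertex S2 jx.
have [i3 o3] := cell_vertex S3 jx.
apply/idP/andP => [/o3|[/o1 c1 /o2 c2]].
  by rewrite -e => -[/i1 ? /i2 ?].
by apply: i3; rewrite -e.
Qed.

Lemma dist_to_le (R : realType) n (d : proj_space R n -> proj_space R n -> R)
    x z (E : set (proj_space R n)) :
  (forall y, E y -> 0 <= d x y) -> E z -> dist_to d x E <= d x z.
Proof.
move=> d0 Ez; apply: ge_inf; last by exists z.
by exists 0 => _ [y Ey <-]; exact: d0.
Qed.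

(** The index found is the vertex of one cell missing from the other: its reflection is the only one
    attached to the common cell that can move points of the first, and it fixes the second
    pointwise. *)
Lemma setD_card1 n (S1 S2 : {set 'I_n.+1}) k : #|S1| = k.+1 -> #|S1 :&: S2| = k ->
  exists i, [/\ i \in S1, i \notin S2 &
    forall j, j \notin S1 :&: S2 -> j != i -> j \notin S1].
Proof.
move=> c1 c12; have /eqP/cards1P[i iE] : #|S1 :\: S2| = 1%N.
  by rewrite cardsD c1 c12 subSnn.
have : i \in S1 :\: S2 by rewrite iE set11.
rewrite inE => /andP[iS2 iS1]; exists i; split=> // j jS ji.
apply: contraNN jS => jS1; rewrite inE jS1 /=; apply: contraNT ji => jS2.
have : j \in S1 :\: S2 by rewrite inE jS2.
by rewrite iE inE.
Qed.

Theorem lemma1 (R : realType) (n : nat) (J : coxeter_diagram n) :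
  circular J -> hyperbolic R J ->
  exists C : R,
    forall (G : hyp_realization R J) (P : GL R n) (rho : R -> rep R J),
      simplicial_deformation_family G P rho ->
      forall (k : nat) (A B : set (proj_space R n)),
        (1 <= k <= n.-1)%N ->
        is_cell P k A -> is_cell P k B -> is_cell P k.-1 (A `&` B) ->
        forall (x y : proj_space R n) (t : R), A x -> B y -> 0 < t ->
          let d := hilbert_dist (tiled_domain P (rho t)) in
          dist_to d x (A `&` B) + dist_to d y (A `&` B) <= C * d x y.
Proof.
move=> [n2 _] hypJ; have [N HN] := parabolic_words_bounded hypJ.
exists (4 * N%:R) => G P rho sdf k A B /andP[k1 _] [S1 c1 ->] [S2 c2 ->].
move=> [S3 c3 e3] x y t Ax By t0; cbv zeta; set d := hilbert_dist _.
have S3E := cellI_set e3; rewrite e3.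
have c12 : #|S1 :&: S2| = k by rewrite -S3E c3 prednK.
have dom := sdf_domain sdf t0; set Omega := tiled_domain P (rho t) in dom d *.
have POm : simplex P `<=` Omega by exact: simplex_sub_domain.
have cellOm S z : cell P S z -> Omega z.
  move=> /cellP[c [cpos _ cz]]; apply: POm; apply/cellP; exists c; split=> // i.
  by rewrite inE.
have [oO pc _ _] := dom.
have [f [Of bO cO fpos]] := exists_positive_form (simplex_lifts P (rho t)) pc.
have d_ge0 p q : Omega p -> Omega q -> 0 <= d p q.
  by move=> Op Oq; exact: (hilbert_dist_ge0 oO Of bO cO).
have dE p q : Omega p -> cell P S3 q -> dist_to d p (cell P S3) <= d p q.
  by move=> Op qE; apply: dist_to_le => // z /cellOm; exact: d_ge0.
have Ox := cellOm _ _ Ax; have Oy := cellOm _ _ By.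
(* For x = y there is no chord to compare with, but the point is then in the common cell and both
   distances to it are at most 0. *)
have [exy|xy] := eqVneq x y.
  have xE : cell P S3 x by rewrite -e3; split=> //; rewrite exy.
  have dxx : d x x = 0 by rewrite /d /hilbert_dist eqxx.
  have := dE x x Ox xE; rewrite -exy dxx mulr0; lra.
have refl_lift i : exists a, [/\ reps (refl_mx P a i) (rho t (cox_gen J i)), a != 0 &
    lform (bary P i) a = 2].
  have [isr fixf] := sdf_reflection sdf i t0.
  apply: reflection_lift => //; first exact: rep_gen_sq.
  by apply: reflection_neq1 isr; exact: ltnW.
have [a aP] := choice refl_lift.
(* As the common cell has a vertex, its complementary set of reflections is proper, and the vertex
   normalizes the matrix lifts of words. *)
have [e eS3] : exists e, e \in S3 by apply/card_gt0P; rewrite c3.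
have SN : words_bounded J (~: S3) N.
  apply: HN; first by split.
  by rewrite properT; apply/eqP => /setP/(_ e); rewrite !inE eS3.
have [i1 [i1S1 i1S2 H1]] := setD_card1 c1 c12.
have c21 : #|S2 :&: S1| = k by rewrite finset.setIC.
have [i2 [i2S2 i2S1 H2]] := setD_card1 c2 c21.
have [v [vpos vS vx]] : exists v, [/\ forall i, 0 <= lform (bary P i) v,
    forall i, i \notin S1 -> lform (bary P i) v = 0 & isrep v x].
  have /cellP[c [cpos cS cx]] := Ax; exists (val P *m c).
  by split=> // i => [|/cS]; rewrite lform_bary_mul.
have [w [wpos wS wy]] : exists v, [/\ forall i, 0 <= lform (bary P i) v,
    forall i, i \notin S2 -> lform (bary P i) v = 0 & isrep v y].
  have /cellP[c [cpos cS cx]] := By; exists (val P *m c).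
  by split=> // i => [|/cS]; rewrite lform_bary_mul.
have coneP u z : (forall i, 0 <= lform (bary P i) u) -> isrep u z -> cone f Omega u.
  move=> upos uz; rewrite -(mulKVmx (valP P) u).
  apply: simplex_cone; [exact: fpos|move=> i|]; first by rewrite -lform_bary.
  have := isrep_neq0 uz; apply: contra_neq => h.
  by rewrite -(mulKVmx (valP P) u) h mulmx0.
have Kv := coneP v x vpos vx; have Kw := coneP w y wpos wy.
have [c c0 [vw wv]] := hilbert_dist_order oO Of bO cO vx wy Kv Kw xy.
set r := expR _ in wv.
have r1 : 1 <= r by rewrite -expR0 ler_expR mulr_ge0// d_ge0.
have r0 : 0 < r := lt_le_trans ltr01 r1.
have lnr : ln r = 2 * d x y by rewrite expRK.
have vS3 i : i \notin S3 -> i != i1 -> lform (bary P i) v = 0.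
  by rewrite S3E => iS3 /(H1 i iS3); exact: vS.
have wS3 i : i \notin S3 -> i != i2 -> lform (bary P i) w = 0.
  by rewrite S3E finset.setIC => iS3 /(H2 i iS3); exact: wS.
have [z zE dxz] := cell_close hypJ dom n2 Of bO cO fpos aP eS3 SN vpos Kv
  vS3 (wS i1 i1S2) c0 r1 vw wv vx.
(* Exchange of roles: w <= c v <= r w gives v <= (r/c) w <= r v, the same comparison with r/c in
   place of c. *)
have K1 : closed_cone f Omega ((r / c) *: w - v).
  have := closed_coneZ (c := c^-1) _ wv; rewrite invr_gt0 => /(_ c0).
  by rewrite scalerBr !scalerA mulVf ?gt_eqF// scale1r mulrC.
have K2 : closed_cone f Omega (r *: v - (r / c) *: w).
  have := closed_coneZ (c := r / c) _ vw; rewrite divr_gt0// => /(_ isT).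
  by rewrite scalerBr !scalerA divfK ?gt_eqF.
have [z' z'E dyz'] := cell_close hypJ dom n2 Of bO cO fpos aP eS3 SN wpos Kw
  wS3 (vS i2 i2S1) (divr_gt0 r0 c0) r1 K1 K2 wy.
have -> : 4 * N%:R * d x y = N%:R * ln r + N%:R * ln r by rewrite lnr; ring.
apply: lerD; first exact: le_trans (dE x z Ox zE) dxz.
exact: le_trans (dE y z' Oy z'E) dyz'.
Qed.
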